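(* Let $\$(k)=O(k^s)$ for some $s\ge0$. Let the weights $\gamma$ have finite algorithmic dimension, and let $\mathrm{decay}_\gamma>1$. Let $\mathcal W\subseteq\mathcal U$ have algorithmic dimension $d\in\mathbb N$ and satisfy $\{u\in\mathcal U:\gamma_u>0\}\subseteq\mathcal W$. Assume that for some $\alpha>0$ there exist non-negative constants $c_1,C,\beta_1,\beta_2$ and, for all $n\in\mathbb N$, quadratures $$Q_n(f)=\sum_{i=1}^na^{(n)}_if(t^{(i,n)}),\qquad a_i^{(n)}\in\mathbb R,\ t^{(i,n)}\in D^d,$$ such that $$e((Q_n)_u;H_u)\le c_1C^{|u|}(n+1)^{-\alpha}(1+\ln(n+1))^{\beta_1|u|+\beta_2}\qquad\text{for all }u\subseteq[d].$$ For $k=1,2,\dots$ let $v_k=\bigcup_{j\in[L_k]}u_j$ with $L_k=L\lceil a^{k-1}\rceil$ ($L\in\mathbb N$, $a\in(1,\infty)$ fixed) and let $Q_{v_k}=Q^{\mathcal W}_{n_k,v_k}$. Then the multilevel algorithms $Q^{\mathrm{ML}}_m$ built from these quadratures establish the following result: the exponent of strong tractability in the nested subspace sampling model satisfies $$p^{\mathrm{nest}}\le\max\left\{\frac1\alpha,\frac{2s}{\mathrm{decay}_\gamma-1}\right\}.$$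
   Context: Setting. $\mathbb N=\{1,2,\dots\}$, $\mathbb N_0=\mathbb N\cup\{0\}$, $[n]=\{1,\dots,n\}$; $\mathcal U$ is the set of all finite subsets of $\mathbb N$. $D\subseteq\mathbb R$ is a Borel set, $K:D\times D\to\mathbb R$ is a measurable, not identically zero reproducing kernel (symmetric, positive semidefinite) with anchor $c\in D$, i.e. $K(c,c)=0$; $H=H(K)$ is its reproducing kernel Hilbert space (RKHS). $\rho$ is a probability measure on $D$ with $M:=\int_DK(x,x)\,\rho(dx)<\infty$ and $C_0:=\int_D\int_DK(x,y)\,\rho(dx)\rho(dy)>0$. For $u\in\mathcal U$ put $K_u(x,y)=\prod_{j\in u}K(x_j,y_j)$ for $x,y\in D^{\mathbb N}$ ($K_\emptyset\equiv1$), $H_u=H(K_u)$; functions in $H_u$ depend only on the coordinates in $u$ and are identified with functions on $D^u$. Weights are families $\gamma=(\gamma_u)_{u\in\mathcal U}$ of non-negative reals with $\sum_u\gamma_uM^{|u|}<\infty$; the set $\mathcal A=\{u\in\mathcal U:\gamma_u>0\}$ is assumed to contain a non-empty set. Let $\mathfrak X=\{x\in D^{\mathbb N}:\sum_{u\in\mathcal A}\gamma_u\prod_{j\in u}K(x_j,x_j)<\infty\}$ and let $\mathcal H_\gamma$ be the RKHS on $\mathfrak X$ with kernel $\sum_{u\in\mathcal A}\gamma_uK_u$. Every $f\in\mathcal H_\gamma$ has a unique representation $f=\sum_{u\in\mathcal A}f_u$, $f_u\in H_u$, and $\|f\|_\gamma^2=\sum_{u\in\mathcal A}\gamma_u^{-1}\|f_u\|_{H_u}^2$.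 $\mu$ is the infinite product of $\rho$ on $D^{\mathbb N}$ (it satisfies $\mu(\mathfrak X)=1$) and $I(f)=\int_{\mathfrak X}f\,d\mu$. Algorithms and errors. For $u\in\mathcal U$, $x\in D^u$, $(x;c)$ is the point of $D^{\mathbb N}$ whose $j$th coordinate is $x_j$ for $j\in u$ and $c$ otherwise. Admissible algorithms: $Q(f)=\sum_{i=1}^na_if(t_{v_i};c)$ with $n\in\mathbb N_0$, $a_i\in\mathbb R$, $v_i\in\mathcal U$, $t_{v_i}\in(D\setminus\{c\})^{v_i}$ (coordinates equal to $c$ are dropped from $v_i$). $e(Q;\mathcal H_\gamma)=\sup_{\|f\|_\gamma\le1}|I(f)-Q(f)|$. For $u\subseteq[d]$ and $g\in H_u$: $(Q_n)_u(g)=\sum_{i=1}^na_i^{(n)}g(t^{(i,n)}_u)$ with $t^{(i,n)}_u=(t^{(i,n)}_j)_{j\in u}$, and $e((Q_n)_u;H_u)=\sup_{\|g\|_{H_u}\le1}|\int_{D^u}g\,d\rho^u-(Q_n)_u(g)|$. Cost (nested subspace sampling). $\$:\mathbb N_0\to[1,\infty)$ is a non-decreasing cost function. For a strictly increasing sequence $w=(w_i)_{i\in\mathbb N}$ of sets in $\mathcal U$ put $\mathfrak c_w(x)=\inf\{\$(|w_i|):x_j=c\ \forall j\notin w_i\}$ ($\inf\emptyset=\infty$); $\mathrm{cost}_{\mathrm{nest}}(Q)=\inf_w\sum_{i=1}^n\mathfrak c_w(t_{v_i};c)$, infimum over all such $w$. Tractability. $\mathrm{comp}_{\mathrm{nest}}(\varepsilon)=\inf\{\mathrm{cost}_{\mathrm{nest}}(Q):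 Q\text{ admissible},\ e(Q;\mathcal H_\gamma)\le\varepsilon\}$; $p^{\mathrm{nest}}$ is the infimum of all $p\ge0$ for which there is $C\ge0$ with $\mathrm{comp}_{\mathrm{nest}}(\varepsilon)\le C\varepsilon^{-p}$ for all $\varepsilon>0$. Algorithmic dimension. The algorithmic dimension of $\mathcal W\subseteq\mathcal U$ is the minimal $d\in\mathbb N$ for which there is a map $\phi:\mathbb N\to[d]$ whose restriction to each $u\in\mathcal W$ is injective (if such $d$ exists; then $\mathcal W$ has finite algorithmic dimension). Weights $\gamma$ have finite algorithmic dimension if $\{u:\gamma_u>0\}$ has. Decay. $\widehat\gamma_u=\gamma_uC_0^{|u|}$; $u_1,u_2,\dots$ are the distinct non-empty $u$ with $\gamma_u>0$, ordered so that $\widehat\gamma_{u_1}\ge\widehat\gamma_{u_2}\ge\cdots$; $\mathrm{decay}_\gamma=\sup\{p\in\mathbb R:\lim_{j\to\infty}\widehat\gamma_{u_j}j^p=0\}$ (equal to $\infty$ if there are only finitely many $u_j$). The algorithms. Fix $\phi:\mathbb N\to[d]$ injective on each $u\in\mathcal W$. For $v\in\mathcal U$ put $Q^{\mathcal W}_{n,v}(f)=\sum_{i=1}^na_i^{(n)}f\big((t^{(i,n)}_{\phi(j)})_{j\in v};c\big)$. Let $v_0=\emptyset$ and $(\Psi_uf)(x)=f(x_u;c)$, $x_u=(x_j)_{j\in u}$. For $m\in\mathbb N$ and integers $n_1\ge\cdots\ge n_m$: $Q^{\mathrm{ML}}_m(f)=f(c,c,\dots)+\sum_{k=1}^mQ_{v_k}(f-\Psi_{v_{k-1}}f)$.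 That these algorithms ''establish'' a bound $p^{\mathrm{nest}}\le B$ means: for every $p>B$ there is $C$ such that for every $\varepsilon\in(0,1]$ some $Q^{\mathrm{ML}}_m$ (for suitable $m,n_1,\dots,n_m$) has $e(Q^{\mathrm{ML}}_m;\mathcal H_\gamma)\le\varepsilon$ and $\mathrm{cost}_{\mathrm{nest}}(Q^{\mathrm{ML}}_m)\le C\varepsilon^{-p}$. *)

(* Defs.v *)
(* The label set of the coordinates is [nat]: the labels 1, 2, ... are shifted  *)
(* to 0, 1, ..., and [d] becomes 'I_d.                                           *)
From HB Require Import structures.
From mathcomp Require Import all_boot all_order all_algebra finmap.
From mathcomp Require Import all_classical all_reals all_analysis.

Set Implicit Arguments.
Unset Strict Implicit.
Unset Printing Implicit Defensive.

Import Order.TTheory GRing.Theory Num.Theory.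
Import numFieldNormedType.Exports.

Local Open Scope classical_set_scope.
Local Open Scope ring_scope.

(* The reproducing kernel Hilbert space with kernel K on the subset X of T.    *)
(* It is a Hilbert space whose elements are, through [rkhs_eval], functions on *)
(* X: two elements with the same values on X are equal, and the values of      *)
(* [rkhs_eval f] outside X are irrelevant. By Moore-Aronszajn it exists (for K *)
(* positive semidefinite on X) and is unique up to a unique isometry that      *)
(* preserves the values on X.                                                  *)
Record rkhs (R : realType) (T : Type) (X : set T) (K : T -> T -> R) := Rkhs {
  rkhs_space :> completeNormedModType R ;
  rkhs_dot : rkhs_space -> rkhs_space -> R ;
  rkhs_dotC : forall f g, rkhs_dot f g = rkhs_dot g f ;
  rkhs_dot_linear : forall (a : R) f g h,
    rkhs_dot (a *: f + g) h = a * rkhs_dot f h + rkhs_dot g h ;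
  rkhs_dot_norm : forall f, rkhs_dot f f = `|f| ^+ 2 ;
  rkhs_eval : rkhs_space -> T -> R ;
  rkhs_eval_linear : forall (a : R) f g x, X x ->
    rkhs_eval (a *: f + g) x = a * rkhs_eval f x + rkhs_eval g x ;
  rkhs_eval_inj : forall f g,
    (forall x, X x -> rkhs_eval f x = rkhs_eval g x) -> f = g ;
  rkhs_section : T -> rkhs_space ;
  rkhs_sectionE : forall x y, X x -> X y ->
    rkhs_eval (rkhs_section x) y = K y x ;
  rkhs_reproducing : forall f x, X x ->
    rkhs_dot f (rkhs_section x) = rkhs_eval f x }.

Definition cylinders (R : realType) (I : Type) : set (set (I -> R)) :=
  [set A | exists i (B : set R),
     measurable B /\ A = [set x : I -> R | B (x i)]].

(* R^I with the product of the Borel sigma-algebras *)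
Notation coords R I := (g_sigma_algebraType (@cylinders R I)).

Section product_spaces.
Context {R : realType}.

Definition is_product_measure (I : choiceType) (rho : probability R R)
    (mu : probability (coords R I) R) : Prop :=
  forall (J : {fset I}) (B : I -> set R), (forall i, measurable (B i)) ->
    mu [set x : coords R I | forall i, i \in J -> B i (x i)] =
    (\prod_(i <- J) rho (B i))%E.

(* D^I *)
Definition box (I : Type) (D : set R) : set (coords R I) :=
  [set x | forall i, D (x i)].

End product_spaces.

(* A linear sampling algorithm f |-> \sum_i a_i f(x_i), as the list of the     *)
(* pairs (a_i, x_i). The cost depends on the list and not only on the          *)
(* functional.                                                                 *)
Definition sampling (R : realType) (T : Type) := seq (R * T).

Definition apply_sampling (R : realType) (T : Type) (Q : sampling R T)
  (f : T -> R) : R := \sum_(p <- Q) p.1 * f p.2.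

Definition worst_case_error (R : realType) d (T : measurableType d)
    (mu : probability T R) (X : set T) (K : T -> T -> R) (H : rkhs X K)
    (Q : sampling R T) : \bar R :=
  ereal_sup [set (`|(\int[mu]_(x in X) rkhs_eval f x) -
                    apply_sampling Q (rkhs_eval f)|)%:E
            | f in [set f : H | `|f| <= 1]].

Section kernels.
Context {R : realType}.
Implicit Types (D : set R) (c : R) (K : R -> R -> R) (rho : probability R R).

Definition is_anchored_kernel D c K : Prop :=
  [/\ D c,
      measurable_fun (D `*` D) (fun p : R * R => K p.1 p.2),
      forall x y, D x -> D y -> K x y = K y x,
      forall n (x b : 'I_n -> R), (forall i, D (x i)) ->
        0 <= \sum_(i < n) \sum_(j < n) b i * b j * K (x i) (x j) &
      (exists x y, [/\ D x, D y & K x y != 0]) /\ K c c = 0].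

Definition diag_integral D K rho : \bar R :=
  (\int[rho]_(x in D) (K x x)%:E)%E.

Definition double_integral D K rho : R :=
  \int[rho]_(x in D) \int[rho]_(y in D) K x y.

(* the kernel K_u on D^u, with the finite type I in the role of u *)
Definition tensor_kernel (I : finType) K (x y : coords R I) : R :=
  \prod_(j : I) K (x j) (y j).

(* the kernel K_u on D^N *)
Definition tensor_kernel_fset K (u : {fset nat}) (x y : coords R nat) : R :=
  \prod_(j <- u) K (x j) (y j).

Implicit Types gam : {fset nat} -> R.

Definition active gam : set {fset nat} := [set u | 0 < gam u].

Definition weighted_domain D K gam : set (coords R nat) :=
  box D `&` [set x | (\esum_(u in active gam)
                       (gam u * tensor_kernel_fset K u x x)%:E < +oo)%E].

(* the kernel \sum_(u in active gam) gam u * K_u; on the weighted domain the   *)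
(* sum is absolutely convergent by the Cauchy-Schwarz inequality               *)
Definition weighted_kernel K gam (x y : coords R nat) : R :=
  let F := fun u => (gam u * tensor_kernel_fset K u x y)%:E in
  fine (\esum_(u in active gam) F^\+ u - \esum_(u in active gam) F^\- u)%E.

Definition is_weights gam (M : R) : Prop :=
  [/\ forall u, 0 <= gam u,
      (\esum_(u in [set: {fset nat}]) (gam u * M ^+ #|` u|)%:E < +oo)%E &
      exists2 u, active gam u & u != fset0].

Definition scaled_weight gam (C0 : R) (u : {fset nat}) : R :=
  gam u * C0 ^+ #|` u|.

(* us 0, us 1, ... are the distinct non-empty elements of [active gam] in the  *)
(* order of non-increasing scaled weights. If there are only N of them, then   *)
(* us j is empty for j >= N.                                                   *)
Definition is_weight_order gam (C0 : R) (us : nat -> {fset nat}) : Prop :=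
  [/\ forall j, us j != fset0 -> active gam (us j),
      forall u, u != fset0 -> active gam u -> exists j, us j = u,
      forall i j, us i != fset0 -> us i = us j -> i = j &
      forall i j, (i <= j)%N -> us j != fset0 ->
        us i != fset0 /\
        scaled_weight gam C0 (us j) <= scaled_weight gam C0 (us i)].

(* equal to +oo if only finitely many us j are non-empty *)
Definition decay gam (C0 : R) (us : nat -> {fset nat}) : \bar R :=
  ereal_sup [set p%:E | p in [set p : R |
    (fun j => if us j == fset0 then 0
              else scaled_weight gam C0 (us j) * j.+1%:R `^ p) @ \oo --> 0]].

End kernels.

Definition injective_on_members (W : set {fset nat}) (d : nat)
    (phi : nat -> 'I_d) : Prop :=
  forall u, W u -> {in u &, injective phi}.

Definition is_algorithmic_dimension (W : set {fset nat}) (d : nat) : Prop :=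
  [/\ (0 < d)%N,
      exists phi : nat -> 'I_d, injective_on_members W phi &
      forall d', (exists phi : nat -> 'I_d', injective_on_members W phi) ->
        (d <= d')%N].

Section algorithms.
Context {R : realType}.
Implicit Types (D : set R) (c : R) (x : coords R nat) (u v : {fset nat}).

(* the point (x_u; c) *)
Definition anchor_at c u x : coords R nat :=
  fun j => if j \in u then x j else c.

Definition Psi c u (f : coords R nat -> R) : coords R nat -> R :=
  fun x => f (anchor_at c u x).

Definition admissible D c (Q : sampling R (coords R nat)) : Prop :=
  forall p, p \in Q -> exists v x,
    (forall j, j \in v -> (D `\ c) (x j)) /\ p.2 = anchor_at c v x.

Implicit Types cost : nat -> R.

Definition nested (w : nat -> {fset nat}) : Prop :=
  forall i, (w i `<` w i.+1)%fset.

Definition point_cost cost c (w : nat -> {fset nat}) x : \bar R :=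
  ereal_inf [set (cost #|` w i|)%:E | i in
              [set i | forall j, j \notin w i -> x j = c]].

Definition cost_nest cost c (Q : sampling R (coords R nat)) : \bar R :=
  ereal_inf [set (\sum_(p <- Q) point_cost cost c w p.2)%E | w in nested].

Section tractability.
Variables (D : set R) (c : R) (cost : nat -> R).
Variables (mu : probability (coords R nat) R).
Variables (X : set (coords R nat)) (K : coords R nat -> coords R nat -> R).
Variable H : rkhs X K.

Definition comp_nest (eps : R) : \bar R :=
  ereal_inf [set cost_nest cost c Q | Q in
    [set Q | admissible D c Q /\ (worst_case_error mu H Q <= eps%:E)%E]].

Definition p_nest : \bar R :=
  ereal_inf [set p%:E | p in [set p : R | 0 <= p /\
    exists2 C : R, 0 <= C & forall eps, 0 < eps ->
      (comp_nest eps <= (C * eps `^ (- p))%:E)%E]].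

End tractability.

(* A sequence of quadratures on D^d: Q_n has the weights a n i and the nodes   *)
(* t n i, for i < n.                                                           *)
Section multilevel.
Variables (d : nat) (a : forall n, 'I_n -> R).
Variable (t : forall n, 'I_n -> coords R 'I_d).

(* (Q_n)_u for u a subset of [d] *)
Definition quadrature_proj (n : nat) (u : {set 'I_d}) :
    sampling R (coords R {j | j \in u}) :=
  [seq (a i, fun j : {j | j \in u} => t i (val j)) | i <- enum 'I_n].

Definition quadrature_lift c (phi : nat -> 'I_d) (n : nat) v :
    sampling R (coords R nat) :=
  [seq (a i, anchor_at c v (fun j => t i (phi j))) | i <- enum 'I_n].

(* v_0 is empty, and v_k is the union of the first L * ceil(b ^ (k - 1)) sets  *)
(* us j for k > 0                                                              *)
Definition level (us : nat -> {fset nat}) (L : nat) (b : R) (k : nat) :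
    {fset nat} :=
  if k is k'.+1 then
    \big[@fsetU nat/fset0]_(j < (L * `|Num.ceil (b ^+ k')|)%N) us j
  else fset0.

(* the algorithm f |-> Q (f - Psi c v f) *)
Definition difference c v (Q : sampling R (coords R nat)) :
    sampling R (coords R nat) :=
  flatten [seq [:: p; (- p.1, anchor_at c v p.2)] | p <- Q].

Definition multilevel c (phi : nat -> 'I_d) (vs : nat -> {fset nat})
    (m : nat) (ns : nat -> nat) : sampling R (coords R nat) :=
  (1, fun=> c) ::
  flatten [seq difference c (vs k.-1) (quadrature_lift c phi (ns k) (vs k))
          | k <- iota 1 m].

Lemma apply_difference c v Q f :
  apply_sampling (difference c v Q) f =
  apply_sampling Q (fun x => f x - Psi c v f x).
Proof.
rewrite /apply_sampling /difference big_flatten big_map /=.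
apply: eq_bigr => p _; rewrite !big_cons big_nil /= addr0.
by rewrite mulNr mulrBr.
Qed.

Lemma apply_multilevel c phi vs m ns f :
  apply_sampling (multilevel c phi vs m ns) f =
  f (fun=> c) +
  \sum_(1 <= k < m.+1) apply_sampling (quadrature_lift c phi (ns k) (vs k))
                         (fun x => f x - Psi c (vs k.-1) f x).
Proof.
rewrite /apply_sampling /multilevel big_cons mul1r; congr (_ + _).
rewrite big_flatten big_map /index_iota subn1 /=.
by apply: eq_bigr => k _; rewrite -!/(apply_sampling _ _) apply_difference.
Qed.

End multilevel.

End algorithms.

(* Main.v *)
Require Import Defs.
From mathcomp Require Import all_boot all_order all_algebra finmap.
From mathcomp Require Import all_classical all_reals all_analysis.
From mathcomp Require Import measurable_realfun ring lra.

Set Implicit Arguments.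
Unset Strict Implicit.
Unset Printing Implicit Defensive.

Import Order.TTheory GRing.Theory Num.Theory.
Import numFieldNormedType.Exports.
Local Open Scope classical_set_scope.
Local Open Scope ring_scope.

(** Why the theorem is true.

    Write l = I - Q for the error functional of an algorithm. In a reproducing
    kernel Hilbert space, l is the inner product with an element h, and h(x) is
    the value of l at the section of the kernel at x. Hence the square of the
    worst case error |h| is l(h) = l_x l_y K(y,x), an expression in which only
    the kernel occurs ([worst_case_errorE]). It is additive in the kernel, so
    for the weighted space it is the sum over the active sets u of gamma_u times
    the squared error of the algorithm in H_u ([sqr_error_weighted]); the error
    analysis takes place in one H_u at a time.

    In H_u a multilevel algorithm is simple. A function of H_u vanishes as soon
    as one coordinate in u is the anchor, and does not depend on the coordinates
    outside u. If k is the first level with u included in v_k, the levels below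
    k see zero and those above k see no difference, so that the algorithm acts
    as Q_(v_k) alone; if u is included in no level, it acts as zero
    ([apply_multilevel_component], [apply_multilevel_outside]). In the first
    case, relabelling the coordinates of u by phi turns the error into the one of
    the given quadrature with n_k nodes in the space of phi(u)
    ([sqr_error_lift]); this gives gamma_u times n_k^(-2 alpha) up to logarithms,
    with constants that are uniform since the active sets have at most d
    elements. In the second case the squared error is C0^|u|.

    The sets that are not included in v_(k-1) come after the first L_(k-1) sets
    of the enumeration. If the scaled weights are O(j^(-(t+1))), their sum is of
    the order L_(k-1)^(-t), hence of the order x^(-k) with x = b^t
    ([tail_weights_le]). The squared error is therefore at most a constant times
    the sum over k <= m of x^(-k) n_k^(-2 al) plus x^(-m), for any al < alpha
    ([sqr_error_multilevel_le]), while the cost is at most a constant times the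
    sum of n_k y^k with y = b^s ([cost_multilevel_growth]), because the sizes of
    the v_k grow like b^k and the v_k form a chain.

    What is left is a choice of m and n_k. If p > 1 / alpha and
    p > 2 s / (decay - 1), then al and t can be chosen such that p al > 1 and
    y < x^(p/2). With x^m of the order eps^(-2) and n_k of the order
    eps^(-p) x^(-p k / 2), both sums are geometric: the cost is dominated by the
    first level and the error by the last one ([multilevel_parameters]). *)

(** * Riesz representation in reproducing kernel Hilbert spaces *)

Section reproducing_kernel_hilbert_space.
Context {R : realType} {T : Type} {X : set T} {K : T -> T -> R}.
Variable H : rkhs X K.
Implicit Types (f g h : H) (a : R).

Local Notation "''<' f , g >" := (rkhs_dot f g)
  (at level 8, f, g at level 60, format "''<' f ,  g >").

Lemma dotDl f g h : '<f + g, h> = '<f, h> + '<g, h>.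
Proof. by rewrite -[f in LHS]scale1r rkhs_dot_linear mul1r. Qed.

Lemma dot0l h : '<0, h> = 0.
Proof.
by apply: (@addrI _ '<0 : H, h>); rewrite -dotDl !addr0.
Qed.

Lemma dotZl a f h : '<a *: f, h> = a * '<f, h>.
Proof. by rewrite -[a *: f]addr0 rkhs_dot_linear dot0l addr0. Qed.

Lemma dotNl f h : '<- f, h> = - '<f, h>.
Proof. by rewrite -scaleN1r dotZl mulN1r. Qed.

Lemma dotBl f g h : '<f - g, h> = '<f, h> - '<g, h>.
Proof. by rewrite dotDl dotNl. Qed.

Lemma dotDr f g h : '<h, f + g> = '<h, f> + '<h, g>.
Proof. by rewrite rkhs_dotC dotDl !(rkhs_dotC h). Qed.

Lemma dotZr a f h : '<h, a *: f> = a * '<h, f>.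
Proof. by rewrite rkhs_dotC dotZl (rkhs_dotC h). Qed.

Lemma dotBr f g h : '<h, f - g> = '<h, f> - '<h, g>.
Proof. by rewrite rkhs_dotC dotBl !(rkhs_dotC h). Qed.

Lemma sqr_normD f g : `|f + g| ^+ 2 = `|f| ^+ 2 + 2 * '<f, g> + `|g| ^+ 2.
Proof.
rewrite -!rkhs_dot_norm dotDl !dotDr (rkhs_dotC g f); ring.
Qed.

Lemma sqr_normB f g : `|f - g| ^+ 2 = `|f| ^+ 2 - 2 * '<f, g> + `|g| ^+ 2.
Proof.
rewrite -!rkhs_dot_norm dotBl !dotBr (rkhs_dotC g f); ring.
Qed.

Lemma sqr_normZ a f : `|a *: f| ^+ 2 = a ^+ 2 * `|f| ^+ 2.
Proof. by rewrite -!rkhs_dot_norm dotZl dotZr mulrA. Qed.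

(** A nonnegative quadratic polynomial has a nonpositive discriminant. *)
Lemma sqr_le_of_quadratic (d e v : R) :
  0 <= e -> 0 <= v -> (forall r : R, 0 <= e + 2 * r * d + r ^+ 2 * v) ->
  d ^+ 2 <= e * v.
Proof.
move=> e0 v0 He; have [vp|] := ltP 0 v; last first.
  move=> vle; have {v0 vle} v0 : v = 0 by apply/eqP; rewrite eq_le vle v0.
  subst v; rewrite mulr0; have [->|d0] := eqVneq d 0; first by rewrite expr0n.
  (* for v = 0 the polynomial is affine; at this point it has the value -1 *)
have := He (- (e + 1) / (2 * d)); rewrite mulr0 addr0.
  have -> : e + 2 * (- (e + 1) / (2 * d)) * d = -1 by field.
  by rewrite lerNr oppr0 ler10.
have := He (- d / v).
have -> : e + 2 * (- d / v) * d + (- d / v) ^+ 2 * v = e - d ^+ 2 / v.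
  by field; rewrite gt_eqF.
by rewrite subr_ge0 ler_pdivrMr.
Qed.

Lemma CauchySchwarz_dot f g : `|'<f, g>| <= `|f| * `|g|.
Proof.
rewrite -(@ler_pXn2r _ 2) // ?nnegrE ?mulr_ge0 //.
rewrite -normrX ger0_norm ?sqr_ge0 // exprMn.
apply: sqr_le_of_quadratic; rewrite ?sqr_ge0 // => r.
have := sqr_ge0 `|f + r *: g|; rewrite sqr_normD dotZr normrZ exprMn.
by rewrite real_normK ?num_real // mulrA.
Qed.

Lemma eval_dot f x : X x -> rkhs_eval f x = '<f, rkhs_section H x>.
Proof. by move=> Xx; rewrite rkhs_reproducing. Qed.

Lemma sqr_norm_section x : X x -> `|rkhs_section H x| ^+ 2 = K x x.
Proof.
by move=> Xx; rewrite -rkhs_dot_norm rkhs_reproducing// rkhs_sectionE.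
Qed.

(** By Cauchy-Schwarz, |f(x)| <= |f| K(x,x)^(1/2); a form without the square
    root is all that integrability needs. *)
Lemma norm_eval_le f x : X x -> `|rkhs_eval f x| <= `|f| * (1 + K x x).
Proof.
move=> Xx; rewrite eval_dot//; apply: (le_trans (CauchySchwarz_dot _ _)).
rewrite ler_wpM2l// -sqr_norm_section//; set u := `|_|; nra.
Qed.

Lemma cvg_dotl (u : nat -> H) f h : u @ \oo --> f ->
  (fun n => '<u n, h>) @ \oo --> '<f, h>.
Proof.
move=> uf; apply/cvgrPdist_le => e e0.
have ep : 0 < e / (1 + `|h|) by rewrite divr_gt0// ltr_pwDl.
near=> n.
rewrite -dotBl (le_trans (CauchySchwarz_dot _ _))//.
have : `|f - u n| <= e / (1 + `|h|).
  by near: n; move/cvgrPdist_le : uf; apply.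
rewrite ler_pdivlMr ?ltr_pwDl// => He.
by apply: le_trans He; rewrite ler_wpM2l// lerDr.
Unshelve. all: by end_near. Qed.

(** A bounded linear form [l] on a linear subspace [V] is represented by an
    element of the closure of [V]: a minimising sequence of
    v |-> |v|^2 - 2 l(v) on [V] is Cauchy by the parallelogram law, and at its
    limit the first variation vanishes. *)
Lemma riesz_on_subspace (V : set H) (l : H -> R) (B : R) :
  V 0 -> (forall a f g, V f -> V g -> V (a *: f + g)) ->
  (forall a f g, V f -> V g -> l (a *: f + g) = a * l f + l g) ->
  (forall f, V f -> `|l f| <= B * `|f|) ->
  exists (u : nat -> H) h,
    [/\ forall n, V (u n), u @ \oo --> h & forall v, V v -> '<h, v> = l v].
Proof.
move=> V0 Vlin llin lB.
pose J (v : H) : R := `|v| ^+ 2 - 2 * l v.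
have l0 : l 0 = 0.
  have := llin 1 0 0 V0 V0; rewrite scale1r addr0 mul1r => /eqP.
  by rewrite -subr_eq0 opprD addrA subrr sub0r oppr_eq0 => /eqP.
have lZ a f : V f -> l (a *: f) = a * l f.
  by move=> Vf; rewrite -[a *: f]addr0 llin// l0 addr0.
have VZ a f : V f -> V (a *: f) by move=> Vf; rewrite -[a *: f]addr0; exact: Vlin.
have Jlb v : V v -> - B ^+ 2 <= J v.
  move=> Vv; have := lB _ Vv; have := ler_norm (l v); rewrite /J.
  set n := `|v| => h1 h2; have := sqr_ge0 (n - B); nra.
pose S := [set J v | v in V].
have hS : has_inf S.
  split; first by exists (J 0), 0.
  by exists (- B ^+ 2) => _ [v Vv <-]; exact: Jlb.
have infS v : V v -> inf S <= J v.
  by move=> Vv; apply: ge_inf; [case: hS | exists v].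
have /choice[u Hu] n : exists v, V v /\ J v < inf S + n.+1%:R^-1.
  have [|_ [v Vv <-] Jv] := @inf_adherent _ S n.+1%:R^-1 _ hS.
    by rewrite invr_gt0.
  by exists v.
have Vu n : V (u n) by case: (Hu n).
have Ju n : J (u n) < inf S + n.+1%:R^-1 by case: (Hu n).
have key n v r : V v -> 0 <= n.+1%:R^-1 + 2 * r * ('<u n, v> - l v) + r ^+ 2 * `|v| ^+ 2.
  (* v |-> |v|^2 - 2 l(v) at u n + r v is at least its infimum on V *)
  move=> Vv; have := infS (r *: v + u n) (Vlin _ _ _ Vv (Vu n)).
  have := Ju n; rewrite /J llin// sqr_normD dotZl (rkhs_dotC v) sqr_normZ.
  move: (inf _) n.+1%:R^-1 (l v) (l (u n)) (`|v|) (`|u n|) ('< _, _>).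
  by move=> *; lra.
have cau n m : `|u n - u m| ^+ 2 <= 2 * n.+1%:R^-1 + 2 * m.+1%:R^-1.
  have := infS ((1/2) *: (u n + u m)).
  have Vs : V (u n + u m) by rewrite -[u n]scale1r; apply: Vlin.
  have ls : l (u n + u m) = l (u n) + l (u m).
    by rewrite -[u n in LHS]scale1r llin// mul1r.
  move=> /(_ (VZ _ _ Vs)); have := Ju n; have := Ju m.
  rewrite /J lZ// ls sqr_normZ sqr_normD sqr_normB.
  move: (inf _) n.+1%:R^-1 m.+1%:R^-1 (l _) (l _) (`|u n|) (`|u m|) ('< _, _>).
  by move=> *; lra.
have cu : cvg (u @ \oo).
  apply: cauchy_cvg; apply: cauchy_exP => e e0.
  have [N HN] : exists N : nat, 4 / e ^+ 2 < N.+1%:R.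
    exists (Num.truncn (4 / e ^+ 2)); rewrite truncnS_gt//.
  exists (u N); exists N => // n /= Nn.
  rewrite -ball_normE/= -(@ltr_pXn2r _ 2) ?nnegrE ?normr_ge0 ?(ltW e0)//.
  apply: (le_lt_trans (cau N n)).
  have ninv : n.+1%:R^-1 <= N.+1%:R^-1 :> R by rewrite lef_pV2 ?posrE// ler_nat.
  move: HN; rewrite ltr_pdivrMr ?exprn_gt0// => HN.
  have : 4 * N.+1%:R^-1 < e ^+ 2 by rewrite ltr_pdivrMr// mulrC.
  apply: le_lt_trans.
  have -> : 4 = 2 + 2 :> R by rewrite -natrD.
  by rewrite [leRHS]mulrDl lerD2l ler_wpM2l.
pose h := lim (u @ \oo).
have uh : u @ \oo --> h := cu.
exists u, h; split => // v Vv.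
have c1 : (fun n => '<u n, v>) @ \oo --> '<h, v> by exact: cvg_dotl.
have c2 : (fun n => '<u n, v>) @ \oo --> l v.
  apply/cvgrPdist_le => e e0.
  have [N HN] : exists N : nat, `|v| ^+ 2 / e ^+ 2 < N.+1%:R.
    by exists (Num.truncn (`|v| ^+ 2 / e ^+ 2)); rewrite truncnS_gt.
  exists N => // n /= Nn.
  rewrite -(@ler_pXn2r _ 2) ?nnegrE ?normr_ge0 ?(ltW e0)// distrC real_normK ?num_real//.
  apply: (@le_trans _ _ (n.+1%:R^-1 * `|v| ^+ 2)).
    by apply: sqr_le_of_quadratic; rewrite ?sqr_ge0// => r; exact: key.
  rewrite mulrC ler_pdivrMr// -ler_pdivrMl ?exprn_gt0// mulrC.
  by rewrite (le_trans (ltW HN))// ler_nat.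
exact: cvg_unique c1 c2.
Qed.

Lemma riesz (l : H -> R) (B : R) :
  (forall a f g, l (a *: f + g) = a * l f + l g) ->
  (forall f, `|l f| <= B * `|f|) ->
  exists h, forall f, '<h, f> = l f.
Proof.
move=> llin lB.
have [u [h [_ _ hl]]] := @riesz_on_subspace setT l B I (fun _ _ _ _ _ => I)
  (fun a f g _ _ => llin a f g) (fun f _ => lB f).
by exists h => f; exact: hl.
Qed.

(** The sections span a dense subspace: a limit of their combinations that has
    the same inner products with the sections as [f] has the values of [f]. *)
Lemma sections_dense (P : H -> Prop) :
  P 0 -> (forall a f g, P f -> P g -> P (a *: f + g)) ->
  (forall x, X x -> P (rkhs_section H x)) ->
  forall f, exists2 u : nat -> H, forall n, P (u n) & u @ \oo --> f.
Proof.
move=> P0 Plin Psec f.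
have flin a g g' : P g -> P g' -> '<f, a *: g + g'> = a * '<f, g> + '<f, g'>.
  by move=> _ _; rewrite dotDr dotZr.
have [u [h [Pu uh hf]]] := riesz_on_subspace P0 Plin flin
  (fun g _ => CauchySchwarz_dot f g).
exists u => //.
suff -> : f = h by [].
by apply: rkhs_eval_inj => x Xx; rewrite !eval_dot// hf//; exact: Psec.
Qed.

End reproducing_kernel_hilbert_space.

(** * The worst case error in terms of the kernel *)

Section error_functional.
Context {R : realType} {d} {T : measurableType d}.
Variables (mu : probability T R) (X : set T).
Hypothesis mX : measurable X.
Implicit Types (Q : sampling R T) (g : T -> R).

Definition error_functional Q g : R :=
  \int[mu]_(x in X) g x - apply_sampling Q g.

Definition sqr_error (K : T -> T -> R) Q : R :=
  error_functional Q (fun x => error_functional Q (fun y => K y x)).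

Lemma eq_error_functional Q g g' : (forall p, p \in Q -> X p.2) ->
  (forall x, X x -> g x = g' x) ->
  error_functional Q g = error_functional Q g'.
Proof.
move=> QX gg'; congr (_ - _).
  by apply: eq_Rintegral => x; rewrite inE => /gg'.
by apply: eq_big_seq => p pQ; rewrite gg'//; exact: QX.
Qed.

Lemma error_functional_linear Q (a : R) g g' :
  mu.-integrable X (EFin \o g) -> mu.-integrable X (EFin \o g') ->
  error_functional Q (fun x => a * g x + g' x) =
  a * error_functional Q g + error_functional Q g'.
Proof.
move=> ig ig'; rewrite /error_functional RintegralD//; last first.
  have -> : EFin \o (fun x => a * g x) = (fun x => a%:E * (EFin \o g) x)%E.
    by apply/funext => x /=; rewrite EFinM.
  exact: integrableZl.
rewrite RintegralZl//.
have -> : apply_sampling Q (fun x => a * g x + g' x) =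
          a * apply_sampling Q g + apply_sampling Q g'.
  rewrite /apply_sampling mulr_sumr -big_split/=; apply: eq_bigr => p _; ring.
ring.
Qed.

Variables (K : T -> T -> R) (H : rkhs X K).
Hypothesis mK : forall x, X x -> measurable_fun X (fun y => K y x).
Hypothesis iK : mu.-integrable X (fun x => (K x x)%:E).

(** Nothing in the definition of the space makes its elements measurable; they
    are, as pointwise limits of combinations of sections. *)
Lemma measurable_eval (f : H) : measurable_fun X (rkhs_eval f).
Proof.
have [||| u mu_ uf] := @sections_dense _ _ _ _ H
    (fun f => measurable_fun X (rkhs_eval f)) _ _ _ f.
- apply: (@eq_measurable_fun _ _ _ _ _ (fun=> 0 : R)); last exact: measurable_cst.
  by move=> x; rewrite inE => Xx; rewrite eval_dot// dot0l.
- move=> a g g' mg mg'.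
  apply: (@eq_measurable_fun _ _ _ _ _ (fun x => a * rkhs_eval g x + rkhs_eval g' x)).
    by move=> x; rewrite inE => Xx; rewrite rkhs_eval_linear.
  by apply: measurable_funD => //; exact: measurable_funM.
- move=> x Xx; apply: (@eq_measurable_fun _ _ _ _ _ (fun y => K y x)); last exact: mK.
  by move=> y; rewrite inE => Xy; rewrite rkhs_sectionE.
- apply: (@measurable_fun_cvg _ _ _ _ (fun n => rkhs_eval (u n))) => // x Xx.
  rewrite eval_dot//; under eq_fun do rewrite eval_dot//.
  exact: cvg_dotl.
Qed.

Lemma integrable_diag1 : mu.-integrable X (fun x => (1 + K x x)%:E).
Proof.
have -> : (fun x => (1 + K x x)%:E) = (fun x => (cst 1 x)%:E + (K x x)%:E)%E.
  by apply/funext => x; rewrite EFinD.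
by apply: integrableD => //; exact: finite_measure_integrable_cst.
Qed.

Lemma integrable_eval (f : H) : mu.-integrable X (EFin \o rkhs_eval f).
Proof.
apply: (@le_integrable _ _ _ mu X mX _ (fun x => (`|f| * (1 + K x x))%:E)).
- by apply/measurable_EFinP; exact: measurable_eval.
- move=> x Xx /=; rewrite lee_fin (le_trans (norm_eval_le f Xx))//.
  exact: ler_norm.
- under eq_fun do rewrite EFinM; apply: integrableZl => //.
  exact: integrable_diag1.
Qed.

(** Point evaluations and the integral are bounded on the space, hence so is
    the error functional. *)
Lemma error_representer Q : (forall p, p \in Q -> X p.2) ->
  exists h : H, forall f, rkhs_dot h f = error_functional Q (rkhs_eval f).
Proof.
move=> QX.
pose B := \int[mu]_(x in X) (1 + K x x) +
          \sum_(p <- Q) `|p.1| * (1 + K p.2 p.2).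
apply: (@riesz _ _ _ _ _ _ B) => [a f g|f].
  rewrite -error_functional_linear ?integrable_eval//.
  by apply: eq_error_functional => // x Xx; rewrite rkhs_eval_linear.
rewrite (le_trans (ler_normB _ _))// mulrDl; apply: lerD.
  rewrite (le_trans (le_normr_Rintegral _ _))//; first exact: integrable_eval.
  rewrite mulrC -RintegralZl//; last exact: integrable_diag1.
  apply: le_Rintegral => //.
  - have := integrable_norm (integrable_eval f).
    by apply: eq_integrable => // x _ /=.
  - have := integrableZl mX `|f| integrable_diag1.
    by apply: eq_integrable => // x _ /=; rewrite EFinM.
  - by move=> x Xx; exact: norm_eval_le.
rewrite mulr_suml (le_trans (ler_norm_sum _ _ _))//.
rewrite big_seq [leRHS]big_seq; apply: ler_sum => p pQ.
rewrite normrM -mulrA ler_wpM2l// mulrC; exact: norm_eval_le (QX _ pQ).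
Qed.

Lemma sqr_norm_representer Q (h : H) : (forall p, p \in Q -> X p.2) ->
  (forall f, rkhs_dot h f = error_functional Q (rkhs_eval f)) ->
  `|h| ^+ 2 = sqr_error K Q.
Proof.
move=> QX hE; rewrite -rkhs_dot_norm hE.
apply: eq_error_functional => // x Xx.
rewrite eval_dot// hE; apply: eq_error_functional => // y Xy.
by rewrite rkhs_sectionE.
Qed.

(** The worst case error is the norm of the Riesz representer [h] of the error
    functional, and h(x) is the error of the algorithm on the section at [x];
    the error thus depends on the kernel only. *)
Lemma worst_case_errorE Q : (forall p, p \in Q -> X p.2) ->
  0 <= sqr_error K Q /\
  worst_case_error mu H Q = (Num.sqrt (sqr_error K Q))%:E.
Proof.
move=> QX; have [h hE] := error_representer QX.
rewrite -(sqr_norm_representer QX hE); split; first exact: sqr_ge0.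
rewrite sqrtr_sqr normr_id; apply/eqP; rewrite eq_le; apply/andP; split.
  apply: ge_ereal_sup => _ [f /= f1 <-]; rewrite lee_fin -/(error_functional _ _).
  rewrite -hE (le_trans (CauchySchwarz_dot _ _))//.
  by rewrite ler_piMr.
have [h0|h0] := eqVneq `|h| 0.
  rewrite h0; apply: ereal_sup_ubound; exists 0 => /=; first by rewrite normr0.
  rewrite -/(error_functional _ _) -hE; congr EFin; apply/normr0P.
  by rewrite rkhs_dotC dot0l.
apply: ereal_sup_ubound; exists (`|h|^-1 *: h) => /=.
  by rewrite normrZ ger0_norm ?invr_ge0// mulVf.
rewrite -/(error_functional _ _) -hE dotZr rkhs_dot_norm expr2 mulrA mulVf//.
by rewrite mul1r normr_id.
Qed.

End error_functional.

(** * Image measures and product measures *)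

Section transport.
Context {R : realType} {d1 d2} {T1 : measurableType d1} {T2 : measurableType d2}.
Variables (m1 : {measure set T1 -> \bar R}) (m2 : {measure set T2 -> \bar R}).
Variables (f : T1 -> T2).
Hypothesis mf : measurable_fun setT f.
Hypothesis m2E : forall A, measurable A -> m2 A = m1 (f @^-1` A).

Lemma ge0_integral_transport D (g : T2 -> \bar R) :
  measurable D -> measurable_fun D g -> (forall y, D y -> (0 <= g y)%E) ->
  (\int[m2]_(y in D) g y = \int[m1]_(x in f @^-1` D) g (f x))%E.
Proof.
move=> mD mg g0.
rewrite -[RHS](@ge0_integral_pushforward _ _ _ _ _ f mf m1 D g)//; last first.
  by move=> y; rewrite inE; exact: g0.
by apply: eq_measure_integral => A mA _; rewrite m2E.
Qed.

(** Both sides are differences of the integrals of the positive and of the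
    negative part, which are transported one by one. *)
Lemma integral_transport D (g : T2 -> \bar R) :
  measurable D -> measurable_fun D g ->
  (\int[m2]_(y in D) g y = \int[m1]_(x in f @^-1` D) g (f x))%E.
Proof.
move=> mD mg; rewrite -[RHS]/(integral m1 _ (g \o f)) integralE [RHS]integralE.
under [X in _ = (X - _)%E]eq_integral do rewrite funepos_comp/=.
under [X in _ = (_ - X)%E]eq_integral do rewrite funeneg_comp/=.
by rewrite -!ge0_integral_transport//;
  [exact: measurable_funeneg|exact: measurable_funepos].
Qed.

Lemma integrable_transport D (g : T2 -> \bar R) : measurable D ->
  m2.-integrable D g -> m1.-integrable (f @^-1` D) (g \o f).
Proof.
move=> mD /integrableP[mg ig].
have mfD : measurable (f @^-1` D) by rewrite -[X in measurable X]setTI; exact: mf.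
apply/integrableP; split.
  apply: (measurable_comp mD _ mg); first by move=> _ [x ? <-].
  exact: measurable_funTS.
move: ig; rewrite ge0_integral_transport//.
exact: measurableT_comp.
Qed.

End transport.

Section full_measure.
Context {R : realType} {d} {T : measurableType d} (mu : probability T R).
Variables X Y : set T.
Hypotheses (mX : measurable X) (mY : measurable Y) (XY : X `<=` Y).
Hypothesis muX : mu X = 1%E.

Let muYX : mu (Y `\` X) = 0%E.
Proof.
apply/eqP; rewrite eq_le measure_ge0 andbT.
have : (mu (Y `\` X) <= mu (~` X))%E.
  by apply: le_measure; rewrite ?inE//;
    do ?[exact: measurableD|exact: measurableC|move=> x []].
by rewrite probability_setC// muX subee.
Qed.

Lemma integral_full_measure (f : T -> \bar R) : measurable_fun Y f ->
  (\int[mu]_(x in X) f x = \int[mu]_(x in Y) f x)%E.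
Proof.
move=> mf.
have key g : measurable_fun Y g -> (forall x, 0 <= g x)%E ->
    (\int[mu]_(x in X) g x = \int[mu]_(x in Y) g x)%E.
  move=> mg g0; rewrite [RHS](@ge0_negligible_integral _ _ _ mu Y (Y `\` X))//.
    by rewrite setDD setIC (setIidl XY).
  exact: measurableD.
by rewrite integralE [RHS]integralE !key//;
  [exact: measurable_funeneg|exact: measurable_funepos].
Qed.

End full_measure.

Section coordinates.
Context {R : realType}.

Lemma measurable_coord (I : choiceType) (i : I) :
  measurable_fun setT (fun x : coords R I => x i).
Proof.
move=> _ B mB; rewrite setTI; apply: sub_sigma_algebra.
by exists i, B; split.
Qed.

Lemma measurable_to_coords {d} (T : measurableType d) (I : choiceType)
    (f : T -> coords R I) :
  (forall i, measurable_fun setT (fun x => f x i)) -> measurable_fun setT f.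
Proof.
move=> mf; apply: (@measurability _ _ T (coords R I) setT f (@cylinders R I) erefl).
move=> _ [_ [i [B [mB ->]]] <-]; rewrite setTI.
by have := mf i measurableT _ mB; rewrite setTI.
Qed.

Definition rectangle (I : choiceType) (J : {fset I}) (B : I -> set R) :
    set (coords R I) := [set x | forall i, i \in J -> B i (x i)].

Lemma measurable_rectangle (I : choiceType) (J : {fset I}) (B : I -> set R) :
  (forall i, measurable (B i)) -> measurable (rectangle J B).
Proof.
move=> mB.
have -> : rectangle J B = \big[setI/setT]_(i <- J) ((fun x : coords R I => x i) @^-1` B i).
  rewrite -bigcap_seq; apply/seteqP; split => x /= Jx i; exact: Jx.
apply: bigsetI_measurable => i _; rewrite -[X in measurable X]setTI.
exact: measurable_coord.
Qed.

Lemma measurable_box (I : countType) (D : set R) : measurable D ->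
  measurable (@box R I D).
Proof.
move=> mD.
pose F n := if choice.unpickle n is Some i
  then (fun x : coords R I => x i) @^-1` D else setT.
have -> : @box R I D = \bigcap_n F n.
  apply/seteqP; split => x /= Dx; last first.
    by move=> i; have := Dx (choice.pickle i) Logic.I; rewrite /F choice.pickleK.
  by move=> n _; rewrite /F; case: choice.unpickle => // i; exact: Dx.
apply: bigcap_measurableType => n _; rewrite /F.
case: choice.unpickle => // i; rewrite -[X in measurable X]setTI.
exact: measurable_coord.
Qed.

(** The rectangles are stable under intersection and generate the product
    sigma-algebra, so they determine a finite measure. *)
Lemma rectangle_measure_unique (I : choiceType)
    (m1 m2 : {measure set (coords R I) -> \bar R}) :
  (m1 setT < +oo)%E ->
  (forall J B, (forall i, measurable (B i)) ->
     m1 (rectangle J B) = m2 (rectangle J B)) ->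
  forall A, measurable A -> m1 A = m2 A.
Proof.
move=> m1T m12.
pose G : set (set (coords R I)) := [set A | exists J B,
  (forall i, measurable (B i)) /\ A = rectangle J B].
apply: (measure_unique G (fun=> setT)).
- apply/seteqP; split.
    apply: sub_sigma_algebra2 => A [i [B [mB ->]]].
    exists [fset i]%fset, (fun=> B); split => //.
    apply/seteqP; split => x /=; first by move=> Bx j; rewrite inE => /eqP ->.
    by apply; rewrite inE.
  apply: smallest_sub; first exact: smallest_sigma_algebra.
  by move=> A [J [B [mB ->]]]; exact: measurable_rectangle.
- move=> _ _ [J [B [mB ->]]] [J' [B' [mB' ->]]].
  exists (J `|` J')%fset, (fun i => (if i \in J then B i else setT) `&`
                                 (if i \in J' then B' i else setT)).
  split; first by move=> i; apply: measurableI; case: ifP.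
  apply/seteqP; split => x /=.
    by move=> [H1 H2] i _; split; case: ifPn => // ?; [exact: H1|exact: H2].
  move=> H; split => i iJ.
    by have := H i; rewrite inE iJ => -[].
  by have := H i; rewrite inE iJ orbT => -[].
- move=> _; exists fset0, (fun=> setT); split => //.
  by apply/seteqP; split => x.
- by rewrite bigcup_const//; exists 0%N.
- by move=> A [J [B [mB ->]]]; exact: m12.
- by [].
Qed.

End coordinates.

Section product_measures.
Context {R : realType} (rho : probability R R).

Lemma rectangle_transport {d} {T : measurableType d} (I : choiceType)
    (m1 : {measure set T -> \bar R}) (m2 : {measure set (coords R I) -> \bar R})
    (f : T -> coords R I) (mf : measurable_fun setT f) : (m2 setT < +oo)%E ->
  (forall J B, (forall i, measurable (B i)) ->
     m2 (rectangle J B) = m1 (f @^-1` rectangle J B)) ->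
  forall A, measurable A -> m2 A = m1 (f @^-1` A).
Proof.
move=> m2T m12 A mA.
by rewrite (@rectangle_measure_unique _ _ m2 (pushforward m1 f)).
Qed.

Lemma product_measure_coord (I : choiceType) (mu : probability (coords R I) R)
    (i : I) : is_product_measure rho mu ->
  forall B, measurable B -> rho B = mu ((fun x : coords R I => x i) @^-1` B).
Proof.
move=> hmu B mB; have := hmu [fset i]%fset (fun=> B) (fun=> mB).
rewrite big_seq_fset1 => <-; congr (mu _); apply/seteqP; split => x /=.
  by apply; rewrite inE.
by move=> Bx j; rewrite inE => /eqP ->.
Qed.

Definition reindex (I J : Type) (sigma : J -> I) (x : coords R I) : coords R J :=
  fun j => x (sigma j).

Lemma measurable_reindex (I J : choiceType) (sigma : J -> I) :
  measurable_fun setT (@reindex I J sigma).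
Proof. by apply: measurable_to_coords => j; exact: measurable_coord. Qed.

(** The preimage of a rectangle is a rectangle: as [sigma] is injective, each
    coordinate is constrained at most once. *)
Lemma product_measure_reindex (I J : choiceType) (sigma : J -> I)
    (mu : probability (coords R I) R) (nu : probability (coords R J) R) :
  injective sigma -> is_product_measure rho mu -> is_product_measure rho nu ->
  forall A, measurable A -> nu A = mu (reindex sigma @^-1` A).
Proof.
move=> sinj hmu hnu; apply: rectangle_transport.
- exact: measurable_reindex.
- by rewrite (le_lt_trans (probability_le1 _ _))// ltry.
move=> E B mB; transitivity (\prod_(j <- E) rho (B j))%E; first exact: hnu.
pose B' i : set R := [set y | forall j, j \in E -> sigma j = i -> B j y].
have B'E j : j \in E -> B' (sigma j) = B j.
  move=> jE; apply/seteqP; split => y /=; first exact.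
  by move=> Bjy k kE /sinj ->.
have mB' i : measurable (B' i).
  have [[j [jE <-]]|nj] := pselect (exists j, j \in E /\ sigma j = i).
    by rewrite B'E.
  have -> : B' i = setT; last by [].
  by apply/seteqP; split => y //= _ j jE ji; exfalso; apply: nj; exists j.
have := hmu (sigma @` E)%fset B' mB'.
rewrite big_imfset/=; last by move=> j k _ _ /sinj.
rewrite (eq_big_seq (fun j => rho (B j))); last first.
  by move=> j jE; rewrite B'E.
move=> <-; congr (mu _); apply/seteqP; split => x /= Bx.
  move=> j jE; have := Bx _ (in_imfset _ _ jE).
  by move=> /(_ j jE erefl).
by move=> i _ j jE ji; rewrite -ji; exact: Bx.
Qed.

Definition merge (I : choiceType) (r : seq I) (z : coords R I * coords R I) :
  coords R I := fun i => if i \in r then z.1 i else z.2 i.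

Lemma measurable_merge (I : choiceType) (r : seq I) :
  measurable_fun setT (@merge I r).
Proof.
apply: measurable_to_coords => i; rewrite /merge; case: (i \in r).
  exact: (measurableT_comp (measurable_coord i) measurable_fst).
exact: (measurableT_comp (measurable_coord i) measurable_snd).
Qed.

(** Independence of the coordinates: resampling some of them does not change
    the product measure. *)
Lemma product_measure_merge (I : choiceType) (r : seq I)
    (mu : probability (coords R I) R) : is_product_measure rho mu ->
  forall A, measurable A -> mu A = (mu \x mu)%E (merge r @^-1` A).
Proof.
move=> hmu; apply: rectangle_transport.
- exact: measurable_merge.
- by rewrite (le_lt_trans (probability_le1 _ _))// ltry.
move=> J B mB.
pose B1 i := if i \in r then B i else setT.
pose B2 i := if i \in r then setT else B i.
have mB1 i : measurable (B1 i) by rewrite /B1; case: ifP.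
have mB2 i : measurable (B2 i) by rewrite /B2; case: ifP.
have -> : merge r @^-1` rectangle J B = rectangle J B1 `*` rectangle J B2.
  apply/seteqP; split => [[x y]/= Bxy|[x y]/= [B1x B2y]].
    by split => i /Bxy; rewrite /merge /B1 /B2; case: ifP.
  by move=> i iJ; have := B1x i iJ; have := B2y i iJ; rewrite /merge /B1 /B2; case: ifP.
transitivity (\prod_(i <- J) rho (B i))%E; first exact: hmu.
apply: esym; transitivity (mu (rectangle J B1) * mu (rectangle J B2))%E.
  by apply: product_measure1E; exact: measurable_rectangle.
rewrite [X in (X * _)%E](hmu J B1 mB1) [X in (_ * X)%E](hmu J B2 mB2).
rewrite -big_split/=; apply: eq_bigr => i _.
by rewrite /B1 /B2; case: ifP => _; rewrite probability_setT ?mule1 ?mul1e.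
Qed.

Lemma integrable_of_transport {d1 d2} {T1 : measurableType d1}
    {T2 : measurableType d2}
    (m1 : {measure set T1 -> \bar R}) (m2 : {measure set T2 -> \bar R})
    (f : T1 -> T2) (mf : measurable_fun setT f)
    (m2E : forall A, measurable A -> m2 A = m1 (f @^-1` A)) (g : T2 -> \bar R) :
  measurable_fun setT g -> m1.-integrable setT (g \o f) ->
  m2.-integrable setT g.
Proof.
move=> mg /integrableP[_ ig]; apply/integrableP; split => //.
rewrite (ge0_integral_transport mf m2E)//.
exact: measurableT_comp.
Qed.

Variables (I : choiceType) (mu : probability (coords R I) R).
Hypothesis hmu : is_product_measure rho mu.

Lemma integrable_coord (f : R -> R) (i : I) :
  rho.-integrable setT (EFin \o f) ->
  mu.-integrable setT (EFin \o (fun x => f (x i))).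
Proof.
move=> fi; have := integrable_transport (measurable_coord i)
  (product_measure_coord i hmu) measurableT fi.
by rewrite preimage_setT.
Qed.

Lemma integral_coord (f : R -> R) (i : I) : measurable_fun setT f ->
  (\int[mu]_x (f (x i))%:E = \int[rho]_x (f x)%:E)%E.
Proof.
move=> mf; rewrite [RHS](integral_transport (measurable_coord i)
  (product_measure_coord i hmu))//; exact/measurable_EFinP.
Qed.

(** By induction, one coordinate at a time: after resampling the coordinates
    outside [r], the new factor and the product over [r] depend on different
    points, and Fubini's theorem separates them. *)
Lemma integral_prod_coords (r : seq I) (f : I -> R -> R) : uniq r ->
  (forall i, i \in r -> rho.-integrable setT (EFin \o f i)) ->
  mu.-integrable setT (EFin \o (fun x => \prod_(i <- r) f i (x i))) /\
  \int[mu]_x (\prod_(i <- r) f i (x i)) = \prod_(i <- r) \int[rho]_y f i y.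
Proof.
elim: r => [_ _|i r IH /= /andP[ir ur] fint].
  split; last first.
    rewrite big_nil; under eq_Rintegral do rewrite big_nil.
    by rewrite Rintegral_cst//= probability_setT/= mulr1.
  rewrite (_ : _ \o _ = cst 1%E); last first.
    by apply/funext => x /=; rewrite big_nil.
  exact: finite_measure_integrable_cst.
have [|hint hE] := IH ur.
  by move=> j jr; apply: fint; rewrite inE jr orbT.
have fi : rho.-integrable setT (EFin \o f i) by apply: fint; rewrite inE eqxx.
have fci := integrable_coord i fi.
set h := (fun x => \prod_(i <- r) f i (x i)) in hint.
pose G (x : coords R I) : \bar R := ((f i (x i))%:E * (h x)%:E)%E.
have GE : EFin \o (fun x : coords R I => \prod_(i <- i :: r) f i (x i)) = G.
  by apply/funext => x; rewrite /G /= big_cons EFinM.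
have mG : measurable_fun setT G.
  apply: emeasurable_funM; first exact: (measurable_int _ fci).
  exact: (measurable_int _ hint).
have mS := @measurable_merge I r.
have muS := @product_measure_merge I r _ hmu.
have GS : G \o merge r = (fun z => (h z.1)%:E * (f i (z.2 i))%:E)%E.
  apply/funext => -[x y]; rewrite /G /= muleC /merge (negbTE ir)/=; congr (_%:E * _)%E.
  by rewrite /h; apply: eq_big_seq => j jr; rewrite jr.
have mGS : measurable_fun setT (G \o merge r) by exact: measurableT_comp.
have iGS : (mu \x mu)%E.-integrable setT (G \o merge r).
  apply: (integrable12ltyP mu mu mGS).2.
  have inner x : (\int[mu]_y `|(G \o merge r) (x, y)| =
      `|(h x)%:E| * \int[mu]_y `|(f i (y i))%:E|)%E.
    rewrite GS/= -ge0_integralZl//; last first.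
      exact: (measurable_int _ (integrable_abse fci)).
    by apply: eq_integral => y _; rewrite /= normrM.
  under eq_integral do rewrite inner.
  rewrite ge0_integralZr//; last 2 first.
  - exact: (measurable_int _ (integrable_abse hint)).
  - exact: integral_ge0.
  move/integrableP : fci => [_ fci]; move/integrableP : hint => [_ hint].
  by apply: lte_mul_pinfty => //; [exact: integral_ge0|rewrite ge0_fin_numE//; exact: integral_ge0].
rewrite GE; split; first exact: (integrable_of_transport mS muS mG iGS).
rewrite /Rintegral.
transitivity (fine (\int[mu]_x G x)%E).
  by congr fine; apply: eq_integral => x _; rewrite -GE.
rewrite (integral_transport mS muS)// preimage_setT -/(integral _ _ (G \o merge r)).
rewrite -(integral12_prod_meas1 iGS) GS /fubini_F/=.
have inner x : (\int[mu]_y ((h x)%:E * (f i (y i))%:E) =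
    (h x)%:E * (\int[rho]_y f i y)%:E)%E.
  rewrite integralZl// integral_coord; last first.
    by have /measurable_EFinP := measurable_int _ fi.
  by rewrite /Rintegral fineK//; exact: integrable_fin_num.
under eq_integral do rewrite inner.
rewrite integralZr// fineM//; last exact: integrable_fin_num.
rewrite big_cons mulrC; congr (_ * _).
exact: hE.
Qed.

End product_measures.

(** * The anchored kernel and its tensor products *)

Section anchored_kernel.
Context {R : realType} (D : set R) (c : R) (K : R -> R -> R).
Hypothesis hK : is_anchored_kernel D c K.

Lemma anchor_in : D c. Proof. by case: hK. Qed.

Lemma sqr_kernel_le x y : D x -> D y -> K x y ^+ 2 <= K x x * K y y.
Proof.
case: hK => _ _ Ksym Kpsd _ Dx Dy.
have diag z : D z -> 0 <= K z z.
  move=> Dz; have := Kpsd 1%N (fun=> z) (fun=> 1) (fun=> Dz).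
  by rewrite !big_ord1 !mul1r.
apply: sqr_le_of_quadratic; rewrite ?diag// => r.
have := Kpsd 2%N (fun i => if i == ord0 then x else y)
  (fun i => if i == ord0 then 1 else r).
rewrite !big_ord_recl !big_ord0/= (Ksym y x)// => H.
have {H}: 0 <= 1 * 1 * K x x + (1 * r * K x y + 0) +
   (r * 1 * K x y + (r * r * K y y + 0) + 0).
  by apply: H => i; case: ifP.
by congr (0 <= _); ring.
Qed.

Lemma norm_le_of_sqr_le (e p q : R) : 0 <= p -> 0 <= q -> e ^+ 2 <= p * q ->
  `|e| <= p + q.
Proof.
move=> p0 q0 epq; rewrite -(@ler_pXn2r _ 2) ?nnegrE ?addr_ge0//.
rewrite real_normK ?num_real//; nra.
Qed.

Lemma kernel_ge0 x : D x -> 0 <= K x x.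
Proof.
case: hK => _ _ _ Kpsd _ Dz.
have := Kpsd 1%N (fun=> x) (fun=> 1) (fun=> Dz).
by rewrite !big_ord1 !mul1r.
Qed.

Lemma norm_kernel_le x y : D x -> D y -> `|K x y| <= K x x + K y y.
Proof.
by move=> Dx Dy; apply: norm_le_of_sqr_le; [exact: kernel_ge0..|exact: sqr_kernel_le].
Qed.

(** This is where the anchor enters: K(c,c) = 0 and Cauchy-Schwarz. *)
Lemma kernel_anchor x : D x -> K x c = 0.
Proof.
move=> Dx; have := sqr_kernel_le Dx anchor_in.
case: hK => _ _ _ _ [_ ->]; rewrite mulr0 => H.
by apply/eqP; rewrite -sqrf_eq0 eq_le H sqr_ge0.
Qed.

Lemma measurable_kernel_section y : measurable D -> D y ->
  measurable_fun D (fun x => K x y).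
Proof.
move=> mD Dy; case: hK => _ mK _ _ _.
apply: (@measurable_comp _ _ _ _ _ _ (D `*` D) (fun p => K p.1 p.2) D
  (fun x => (x, y))) => //.
- exact: measurableX.
- by move=> _ [x Dx <-].
- by apply: measurable_funTS; exact: pair2_measurable.
Qed.

Lemma measurable_kernel_diag : measurable D -> measurable_fun D (fun x => K x x).
Proof.
move=> mD; case: hK => _ mK _ _ _.
apply: (@measurable_comp _ _ _ _ _ _ (D `*` D) (fun p => K p.1 p.2) D
  (fun x => (x, x))) => //.
- exact: measurableX.
- by move=> _ [x Dx <-].
- by apply: measurable_funTS; exact: measurable_fun_pair.
Qed.

Definition coord_kernel (I : Type) (r : seq I) (x y : coords R I) : R :=
  \prod_(i <- r) K (x i) (y i).

Section coord_kernel.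
Context (I : eqType) (r : seq I).
Implicit Types x y : coords R I.

Lemma coord_kernel_sym x y : box D x -> box D y ->
  coord_kernel r x y = coord_kernel r y x.
Proof.
move=> Dx Dy; case: hK => _ _ Ksym _ _.
by apply: eq_bigr => i _; rewrite Ksym.
Qed.

Lemma coord_kernel_diag_ge0 x : box D x -> 0 <= coord_kernel r x x.
Proof. by move=> Dx; apply: prodr_ge0 => i _; exact: kernel_ge0. Qed.

(** A bound by a sum, rather than by the geometric mean, is integrable and
    summable without further argument. *)
Lemma norm_coord_kernel_le x y : box D x -> box D y ->
  `|coord_kernel r x y| <= coord_kernel r x x + coord_kernel r y y.
Proof.
move=> Dx Dy; have px := coord_kernel_diag_ge0 Dx; have py := coord_kernel_diag_ge0 Dy.
apply: norm_le_of_sqr_le => //.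
rewrite /coord_kernel -prodrXl -big_split/=; apply: ler_prod => i _.
by rewrite sqr_ge0/=; exact: sqr_kernel_le.
Qed.

Lemma coord_kernel_anchor x y i : box D x -> i \in r -> y i = c ->
  coord_kernel r x y = 0.
Proof.
move=> Dx ir yi; apply/eqP; rewrite prodf_seq_eq0; apply/hasP; exists i => //=.
by rewrite yi kernel_anchor.
Qed.

End coord_kernel.

End anchored_kernel.

Section kernel_integrals.
Context {R : realType} (D : set R) (c : R) (K : R -> R -> R).
Hypothesis hK : is_anchored_kernel D c K.
Hypothesis mD : measurable D.
Variable rho : probability R R.
Hypothesis hM : (diag_integral D K rho < +oo)%E.

Lemma integrable_kernel_diag : rho.-integrable D (fun x => (K x x)%:E).
Proof.
apply/integrableP; split.
  by apply/measurable_EFinP; exact: measurable_kernel_diag hK mD.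
move: hM; apply: le_lt_trans; rewrite le_eqVlt; apply/orP; left; apply/eqP.
by apply: eq_integral => x; rewrite inE => Dx /=; rewrite ger0_norm// (kernel_ge0 hK).
Qed.

Lemma integrable_kernel_section y : D y ->
  rho.-integrable D (fun x => (K x y)%:E).
Proof.
move=> Dy; apply: (@le_integrable _ _ _ rho D mD _ (fun x => (K x x)%:E + (cst (K y y) x)%:E)%E).
- by apply/measurable_EFinP; exact: (measurable_kernel_section hK).
- move=> x Dx /=; rewrite lee_fin (le_trans (norm_kernel_le hK Dx Dy))//.
  exact: ler_norm.
- by apply: integrableD => //; [exact: integrable_kernel_diag|
    exact: finite_measure_integrable_cst].
Qed.

Definition kernel_mean (y : R) : R := \int[rho]_(x in D) K x y.

(** Fubini's theorem on D x D, where |K(x,y)| <= K(x,x) + K(y,y). *)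
Lemma kernel_mean_integral : rho.-integrable D (EFin \o kernel_mean) /\
  \int[rho]_(y in D) kernel_mean y = double_integral D K rho.
Proof.
(* Fubini's theorem is for the whole plane: K is extended by zero *)
pose F : R * R -> \bar R := (fun p => (K p.1 p.2)%:E) \_ (D `*` D).
have mDD : measurable (D `*` D) by exact: measurableX.
have mF : measurable_fun setT F.
  apply/(measurable_restrictT _ mDD); apply/measurable_EFinP; case: hK => _ + _ _ _; exact.
have FE x y : D x -> D y -> F (x, y) = (K x y)%:E.
  by move=> Dx Dy; rewrite /F patchE mem_set.
have F0 x y : ~ D y -> F (x, y) = 0%E.
  by move=> Dy; rewrite /F patchE memNset// => -[].
pose k : R -> \bar R := (fun x => (K x x)%:E) \_ D.
have ik : rho.-integrable setT k.
  exact: (iffLR (integrable_mkcond _ mD) integrable_kernel_diag).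
have ikf (phi : R * R -> R) : measurable_fun setT phi ->
    (forall A, measurable A -> rho A = (rho \x rho)%E (phi @^-1` A)) ->
    (rho \x rho)%E.-integrable setT (k \o phi).
  move=> mphi phiE.
  by have := integrable_transport mphi phiE measurableT ik; rewrite preimage_setT.
have i1 : (rho \x rho)%E.-integrable setT (k \o fst).
  apply: ikf => // A mA.
  have -> : fst @^-1` A = A `*` [set: R].
    by apply/seteqP; split => -[x y] //= [].
  apply: esym; transitivity (rho A * rho setT)%E; first exact: product_measure1E.
  by rewrite probability_setT mule1.
have i2 : (rho \x rho)%E.-integrable setT (k \o snd).
  apply: ikf => // A mA.
  have -> : snd @^-1` A = [set: R] `*` A.
    by apply/seteqP; split => -[x y] //= [].
  apply: esym; transitivity (rho setT * rho A)%E; first exact: product_measure1E.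
  by rewrite probability_setT mul1e.
have iF : (rho \x rho)%E.-integrable setT F.
  apply: (@le_integrable _ _ _ (rho \x rho)%E setT measurableT _ ((k \o fst) \+ (k \o snd))%E) => //.
    move=> [x y] _; rewrite /F /k /= !patchE.
    case: ifPn => [|_]; last by rewrite abse0.
    rewrite inE => -[/= Dx Dy]; rewrite !mem_set//= lee_fin.
    by rewrite (le_trans (norm_kernel_le hK Dx Dy))// ler_norm.
  exact: integrableD.
case: hK => _ _ Ksym _ _.
have FD x : D x -> (\int[rho]_y F (x, y) = \int[rho]_(y in D) (K x y)%:E)%E.
  move=> Dx; rewrite [RHS]integral_mkcond; apply: eq_integral => y _.
  rewrite /F !patchE; case: (boolP (y \in D)) => yD.
    by rewrite mem_set//; split => //; rewrite inE in yD.
  rewrite memNset// => -[/= _ Dy]; move: yD; rewrite notin_setE; exact.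
have GE x : D x -> (\int[rho]_y F (x, y) = (kernel_mean x)%:E)%E.
  move=> Dx; rewrite FD// /kernel_mean /Rintegral fineK; last first.
    by apply: integrable_fin_num => //; exact: integrable_kernel_section.
  by apply: eq_integral => y; rewrite inE => Dy; rewrite Ksym.
have FEr : fubini_F rho F = (EFin \o kernel_mean) \_ D.
  apply/funext => x; rewrite patchE /fubini_F; case: ifPn => xD.
    by rewrite GE//; rewrite inE in xD.
  rewrite integral0_eq// => y _; rewrite /F patchE memNset// => -[/= Dx _].
  by move: xD; rewrite notin_setE.
split.
  apply: (iffRL (integrable_mkcond _ mD)).
  by rewrite -FEr; exact: (integrable_fubini_F iF).
rewrite /double_integral; apply: eq_Rintegral => x; rewrite inE => Dx.
by apply: (congr1 fine); rewrite -FD// GE// /kernel_mean /Rintegral fineK//;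
  apply: integrable_fin_num => //; exact: integrable_kernel_section.
Qed.

End kernel_integrals.

Section coord_kernel_integrals.
Context {R : realType} (D : set R) (c : R) (K : R -> R -> R).
Hypothesis hK : is_anchored_kernel D c K.
Hypothesis mD : measurable D.
Variable rho : probability R R.
Hypothesis hM : (diag_integral D K rho < +oo)%E.
Variables (I : choiceType) (mu : probability (coords R I) R).
Hypothesis hmu : is_product_measure rho mu.
Variable X : set (coords R I).
Hypotheses (mX : measurable X) (XD : X `<=` box D) (muX : mu X = 1%E).

Lemma integral_prod_coords_on (r : seq I) (f : I -> R -> R) : uniq r ->
  (forall i, i \in r -> rho.-integrable D (EFin \o f i)) ->
  mu.-integrable X (EFin \o (fun x => \prod_(i <- r) f i (x i))) /\
  \int[mu]_(x in X) (\prod_(i <- r) f i (x i)) =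
    \prod_(i <- r) \int[rho]_(y in D) f i y.
Proof.
move=> ur fi.
have [|ig Eg] := @integral_prod_coords _ _ _ _ hmu r (fun i => f i \_ D) ur.
  move=> i ir; rewrite -restrict_EFin.
  exact: (iffLR (integrable_mkcond _ mD) (fi i ir)).
have XE x : X x -> \prod_(i <- r) (f i \_ D) (x i) = \prod_(i <- r) f i (x i).
  by move=> /XD Dx; apply: eq_bigr => i _; rewrite patchE mem_set.
have iX := integrableS measurableT mX (@subsetT _ _) ig; split.
  by apply: eq_integrable iX => // x; rewrite inE => Xx /=; rewrite XE.
under [RHS]eq_bigr do rewrite Rintegral_mkcond.
rewrite -Eg /Rintegral; congr fine.
rewrite -(@integral_full_measure _ _ _ mu X setT)//; last exact: measurable_int ig.
by apply: eq_integral => x; rewrite inE => Xx; rewrite XE.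
Qed.

Lemma integral_coord_kernel_diag (r : seq I) : uniq r ->
  mu.-integrable X (fun x => (coord_kernel K r x x)%:E) /\
  \int[mu]_(x in X) coord_kernel K r x x =
    fine (diag_integral D K rho) ^+ size r.
Proof.
move=> ur; have [|ig Eg] := @integral_prod_coords_on r (fun _ x => K x x) ur.
  by move=> i _; exact: (integrable_kernel_diag hK mD hM).
by split => //; rewrite [LHS]Eg big_const_seq count_predT iter_mulr_1.
Qed.

Lemma integral_coord_kernel (r : seq I) y : uniq r -> box D y ->
  mu.-integrable X (fun x => (coord_kernel K r x y)%:E) /\
  \int[mu]_(x in X) coord_kernel K r x y = \prod_(i <- r) kernel_mean D K rho (y i).
Proof.
move=> ur Dy; have [|ig Eg] := @integral_prod_coords_on r (fun i x => K x (y i)) ur.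
  by move=> i _; exact: (integrable_kernel_section hK mD hM (Dy i)).
by split.
Qed.

Lemma integral_prod_kernel_mean (r : seq I) : uniq r ->
  mu.-integrable X (fun y => (\prod_(i <- r) kernel_mean D K rho (y i))%:E) /\
  \int[mu]_(y in X) \prod_(i <- r) kernel_mean D K rho (y i) =
    double_integral D K rho ^+ size r.
Proof.
move=> ur; have [kint kE] := kernel_mean_integral hK mD hM.
have [//|ig Eg] := @integral_prod_coords_on r (fun _ => kernel_mean D K rho) ur.
by split => //; rewrite [LHS]Eg kE big_const_seq count_predT iter_mulr_1.
Qed.

End coord_kernel_integrals.

(** * The error in the weighted space as a sum over the active sets *)

Section error_functional_limits.
Context {R : realType} {d} {T : measurableType d}.
Variables (mu : probability T R) (X : set T).
Hypothesis mX : measurable X.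
Variable Q : sampling R T.
Hypothesis QX : forall p, p \in Q -> X p.2.
Implicit Types (g b : T -> R).

Lemma dominated_integrable_real g b : measurable_fun X g ->
  (forall x, X x -> `|g x| <= b x) -> mu.-integrable X (EFin \o b) ->
  mu.-integrable X (EFin \o g).
Proof.
move=> mg gb; apply: le_integrable => //; first exact/measurable_EFinP.
by move=> x Xx /=; rewrite lee_fin (le_trans (gb _ Xx))// ler_norm.
Qed.

Definition error_bound b : R :=
  \int[mu]_(x in X) b x + \sum_(p <- Q) `|p.1| * b p.2.

Lemma norm_error_functional_le g b : measurable_fun X g ->
  (forall x, X x -> `|g x| <= b x) -> mu.-integrable X (EFin \o b) ->
  `|error_functional mu X Q g| <= error_bound b.
Proof.
move=> mg gb ib; have ig := dominated_integrable_real mg gb ib.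
rewrite (le_trans (ler_normB _ _))//; apply: lerD.
  rewrite (le_trans (le_normr_Rintegral _ _))//; apply: le_Rintegral => //.
  by apply: eq_integrable (integrable_norm ig) => // x _ /=.
rewrite (le_trans (ler_norm_sum _ _ _))// big_seq [leRHS]big_seq.
apply: ler_sum => p pQ; rewrite normrM ler_wpM2l//; exact: gb (QX pQ).
Qed.

(** Dominated convergence for the integral, pointwise convergence at the
    nodes. *)
Lemma error_functional_cvg (g_ : nat -> T -> R) g b :
  (forall n, measurable_fun X (g_ n)) ->
  (forall x, X x -> (fun n => g_ n x) @ \oo --> g x) ->
  (forall n x, X x -> `|g_ n x| <= b x) -> mu.-integrable X (EFin \o b) ->
  (fun n => error_functional mu X Q (g_ n)) @ \oo -->
    error_functional mu X Q g.
Proof.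
move=> mg gg gb ib.
have mlim := measurable_fun_cvg mg gg.
have [|||||ig _ Ig] := @dominated_convergence _ _ _ mu X mX
    (fun n => EFin \o g_ n) (EFin \o g) (EFin \o b).
- by move=> n; apply/measurable_EFinP.
- exact/measurable_EFinP.
- by apply/aeW => x Xx; apply: cvg_EFin; [exact: nearW|exact: gg].
- exact: ib.
- by apply/aeW => x n Xx /=; rewrite lee_fin gb.
apply: cvgB.
  have fin : (\int[mu]_(x in X) (EFin \o g) x)%E \is a fin_num.
    exact: integrable_fin_num.
  rewrite /Rintegral; apply: (@fine_cvg _ _ _ _ (fun n => \int[mu]_(x in X) (EFin \o g_ n) x)%E).
  by rewrite fineK.
rewrite /apply_sampling; under eq_fun do rewrite big_seq; rewrite big_seq.
apply: cvg_big => [|p pQ]; first exact: add_continuous.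
by apply: cvgMl_tmp; apply: gg; exact: QX.
Qed.

Lemma error_functional_sum (w : nat -> R) (g_ : nat -> T -> R) n :
  (forall i, mu.-integrable X (EFin \o g_ i)) ->
  error_functional mu X Q (fun x => \sum_(i < n) w i * g_ i x) =
  \sum_(i < n) w i * error_functional mu X Q (g_ i).
Proof.
move=> ig; have isum k : mu.-integrable X (EFin \o (fun x => \sum_(i < k) w i * g_ i x)).
  have -> : (EFin \o (fun x => \sum_(i < k) w i * g_ i x)) =
      (fun x => \sum_(i < k) (w i)%:E * (EFin \o g_ i) x)%E.
    by apply/funext => x /=; rewrite -sumEFin; apply: eq_bigr => i _; rewrite EFinM.
  by apply: integrable_sum => // i _; exact: integrableZl.
elim: n => [|n IH].
  rewrite big_ord0 (@eq_error_functional _ _ _ _ _ _ _ (fun=> 0))//.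
    rewrite /error_functional /apply_sampling big1 ?subr0.
      by rewrite Rintegral_cst// mul0r.
    by move=> p _; rewrite mulr0.
  by move=> x _; rewrite big_ord0.
rewrite big_ord_recr /= -IH.
rewrite (@eq_error_functional _ _ _ _ _ _ _ (fun x => w n * g_ n x + \sum_(i < n) w i * g_ i x))//.
  by rewrite error_functional_linear// addrC.
by move=> x _; rewrite big_ord_recr addrC.
Qed.

End error_functional_limits.

Lemma nneseries_cvg_fine (R : realType) (f : nat -> R) : (forall i, 0 <= f i) ->
  (\sum_(0 <= i <oo) (f i)%:E < +oo)%E ->
  (fun n => \sum_(i < n) f i) @ \oo --> fine (\sum_(0 <= i <oo) (f i)%:E)%E.
Proof.
move=> f0 foo.
have cf : cvg ((fun n => \sum_(0 <= i < n) (f i)%:E)%E @ \oo).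
  by apply: is_cvg_nneseries => n _ _; rewrite lee_fin.
have -> : (fun n => \sum_(i < n) f i) =
    fine \o (fun n => \sum_(0 <= i < n) (f i)%:E)%E.
  by apply/funext => n /=; rewrite sumEFin/= big_mkord.
apply: fine_cvg; rewrite fineK//.
by rewrite ge0_fin_numE//; apply: nneseries_ge0 => n _ _; rewrite lee_fin.
Qed.

Lemma sum_le_fine_nneseries (R : realType) (f : nat -> R) n :
  (forall i, 0 <= f i) -> (\sum_(0 <= i <oo) (f i)%:E < +oo)%E ->
  \sum_(i < n) f i <= fine (\sum_(0 <= i <oo) (f i)%:E)%E.
Proof.
move=> f0 foo; rewrite -lee_fin fineK; last first.
  by rewrite ge0_fin_numE//; apply: nneseries_ge0 => k _ _; rewrite lee_fin.
rewrite -(big_mkord xpredT f) -sumEFin; apply: nneseries_lim_ge => k _ _.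
by rewrite lee_fin.
Qed.

Lemma measure_box (R : realType) (rho : probability R R) (I : countType)
    (mu : probability (coords R I) R) (D : set R) :
  measurable D -> rho D = 1%E -> is_product_measure rho mu ->
  mu (box D) = 1%E.
Proof.
move=> mD rhoD hmu.
pose F n := if choice.unpickle n is Some i
  then (fun x : coords R I => x i) @^-1` (~` D) else set0.
suff : mu (~` @box R I D) = 0%E.
  have mB := @measurable_box R I D mD.
  move=> h; rewrite -[X in mu X]setCK probability_setC; last exact: measurableC.
  by rewrite h sube0.
apply/negligibleP; first by apply: measurableC; exact: measurable_box.
have -> : ~` @box R I D = \bigcup_n F n.
  apply/seteqP; split => x /=.
    move=> /existsNP[i Dx]; exists (choice.pickle i) => //.
    by rewrite /F choice.pickleK.
  by move=> [n _]; rewrite /F; case: choice.unpickle => // i Dx /(_ i).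
apply: negligible_bigcup => n; rewrite /F; case: choice.unpickle => [i|]; last exact: negligible_set0.
apply/negligibleP.
  rewrite -[X in measurable X]setTI; apply: measurable_coord => //.
  exact: measurableC.
transitivity (rho (~` D)).
  exact: (esym (product_measure_coord i hmu (measurableC mD))).
by rewrite probability_setC// rhoD subee.
Qed.

Section weighted_space.
Context {R : realType} (D : set R) (c : R) (K : R -> R -> R).
Hypothesis hK : is_anchored_kernel D c K.
Hypothesis mD : measurable D.
Variable rho : probability R R.
Hypothesis rhoD : rho D = 1%E.
Hypothesis hM : (diag_integral D K rho < +oo)%E.
Variable mu : probability (coords R nat) R.
Hypothesis hmu : is_product_measure rho mu.
Variables (gam : {fset nat} -> R) (U : nat -> {fset nat}) (w : nat -> R).
Hypothesis gam0 : forall u, 0 <= gam u.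
Hypothesis w0 : forall i, 0 <= w i.
Hypothesis esum_enum : forall k : {fset nat} -> R, (forall u, 0 <= k u) ->
  (\esum_(u in active gam) (gam u * k u)%:E =
   \sum_(0 <= i <oo) (w i * k (U i))%:E)%E.
Hypothesis weights_summable :
  (\sum_(0 <= i <oo) (w i * fine (diag_integral D K rho) ^+ #|` U i|)%:E < +oo)%E.

Let X := weighted_domain D K gam.
Let k i := @coord_kernel R K nat (U i).
Let S x := (\sum_(0 <= i <oo) (w i * k i x x)%:E)%E.

Lemma weighted_domainE : X = box D `&` [set x | (S x < +oo)%E].
Proof.
rewrite /X /weighted_domain; apply/seteqP; split => x [Dx /= Sx]; split => //=;
  by move: Sx; rewrite esum_enum// => u; exact: (coord_kernel_diag_ge0 hK).
Qed.

Lemma weighted_domain_box : X `<=` box D. Proof. by move=> x []. Qed.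

Let k_ge0 i x : box D x -> 0 <= k i x x.
Proof. exact: (coord_kernel_diag_ge0 hK). Qed.

Lemma measurable_coord_kernel (r : seq nat) y : box D y ->
  measurable_fun (box D) (fun x => coord_kernel K r x y).
Proof.
move=> Dy; apply: measurable_prod => i _.
apply: (@measurable_comp _ _ _ _ _ _ D (fun x => K x (y i)) (box D)
  (fun x : coords R nat => x i)) => //.
- by move=> _ [x Dx <-].
- exact: (measurable_kernel_section hK).
- by apply: measurable_funTS; exact: measurable_coord.
Qed.

Let muB : mu (box D) = 1%E := measure_box mD rhoD hmu.

Let diagB i := integral_coord_kernel_diag hK mD hM hmu (measurable_box mD)
  (@subset_refl _ _) muB (fset_uniq (U i)).

Let measurable_k_diag i : measurable_fun (box D) (fun x => k i x x).
Proof. by apply/measurable_EFinP; exact: (measurable_int _ (diagB i).1). Qed.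

Let mS : measurable_fun (box D) S.
Proof.
have := @ge0_emeasurable_sum _ _ _ (box D) (fun i x => (w i * k i x x)%:E) xpredT.
apply.
  by move=> i x Dx _; rewrite lee_fin mulr_ge0// k_ge0.
by move=> i _; apply/measurable_EFinP; exact: measurable_funM.
Qed.

Lemma measurable_weighted_domain : measurable X.
Proof.
rewrite weighted_domainE.
have := emeasurable_fun_infty_o (measurable_box mD) mS +oo%E.
by [].
Qed.

Let integral_S : (\int[mu]_(x in box D) S x < +oo)%E.
Proof.
rewrite integral_nneseries//.
- move: weights_summable; congr (_ < _)%E; apply: eq_eseriesr => i _.
  have [ik Ek] := diagB i.
  under eq_integral do rewrite EFinM.
  rewrite integralZl//; last exact: measurable_box.
  rewrite EFinM; congr (_ * _)%E.
  rewrite -Ek /Rintegral fineK//; apply: integrable_fin_num => //.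
  exact: measurable_box.
- exact: measurable_box.
- by move=> i; apply/measurable_EFinP; exact: measurable_funM.
- by move=> i x Dx; rewrite lee_fin mulr_ge0// k_ge0.
Qed.

Let S_ge0 x : box D x -> (0 <= S x)%E.
Proof.
by move=> Dx; apply: nneseries_ge0 => i _ _; rewrite lee_fin mulr_ge0// k_ge0.
Qed.

Let integrable_S : mu.-integrable (box D) S.
Proof.
apply/integrableP; split => //; move: integral_S; congr (_ < _)%E.
by apply: eq_integral => x; rewrite inE => Dx; rewrite gee0_abs// S_ge0.
Qed.

(** The sum that defines the domain has the finite integral
    sum_u gamma_u M^|u|, so it is finite almost everywhere. *)
Lemma measure_weighted_domain : mu X = 1%E.
Proof.
have mX := measurable_weighted_domain.
apply/eqP; rewrite eq_le probability_le1//=.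
have [N [mN N0 HN]] := integrable_ae (measurable_box mD) integrable_S.
have : (mu (box D) <= mu (X `|` N))%E.
  apply: le_measure; rewrite ?inE; [exact: measurable_box|exact: measurableU|].
  move=> x Dx; have [Nx|Nx] := pselect (N x); first by right.
  left; rewrite weighted_domainE; split => //=.
  have [/(_ Dx)|h] := pselect (box D x -> S x \is a fin_num).
    by rewrite ge0_fin_numE// S_ge0.
  by exfalso; apply: Nx; exact: HN.
rewrite muB => /le_trans; apply.
apply: (le_trans (measureU2 mu mX mN)).
by rewrite [X in (_ + X)%E]N0 adde0.
Qed.

Definition diag_sum x : R := fine (S x).

Let X_fin x : X x -> (S x < +oo)%E.
Proof. by rewrite weighted_domainE => -[]. Qed.

Lemma integrable_diag_sum : mu.-integrable X (EFin \o diag_sum).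
Proof.
have := integrableS (measurable_box mD) measurable_weighted_domain
  weighted_domain_box integrable_S.
apply: eq_integrable; first exact: measurable_weighted_domain.
move=> x; rewrite inE => Xx /=; rewrite /diag_sum fineK//.
by rewrite ge0_fin_numE ?X_fin// S_ge0//; exact: weighted_domain_box.
Qed.

Definition partial_kernel n (x y : coords R nat) : R :=
  \sum_(i < n) w i * k i x y.

Let pairs_summable x y : X x -> X y ->
  (\sum_(0 <= i <oo) (w i * (k i x x + k i y y))%:E < +oo)%E.
Proof.
move=> Xx Xy; have [Dx Dy] := (weighted_domain_box Xx, weighted_domain_box Xy).
under eq_eseriesr do rewrite mulrDr EFinD.
rewrite nneseriesD; first exact: lte_add_pinfty (X_fin Xx) (X_fin Xy).
- by move=> i _ _; rewrite lee_fin mulr_ge0// k_ge0.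
- by move=> i _ _; rewrite lee_fin mulr_ge0// k_ge0.
Qed.

Lemma norm_partial_kernel_le n x y : X x -> X y ->
  `|partial_kernel n x y| <= diag_sum x + diag_sum y.
Proof.
move=> Xx Xy; have [Dx Dy] := (weighted_domain_box Xx, weighted_domain_box Xy).
rewrite (le_trans (ler_norm_sum _ _ _))//.
apply: (@le_trans _ _ (\sum_(i < n) (w i * k i x x + w i * k i y y))).
  apply: ler_sum => i _; rewrite normrM ger0_norm// -mulrDr ler_wpM2l//.
  exact: (norm_coord_kernel_le hK).
rewrite big_split/=; apply: lerD; rewrite /diag_sum /S.
  by apply: (@sum_le_fine_nneseries R (fun i => w i * k i x x)) => [i|];
    [rewrite mulr_ge0// k_ge0|exact: X_fin].
by apply: (@sum_le_fine_nneseries R (fun i => w i * k i y y)) => [i|];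
  [rewrite mulr_ge0// k_ge0|exact: X_fin].
Qed.

Lemma partial_kernel_cvg x y : X x -> X y ->
  (fun n => partial_kernel n x y) @ \oo --> weighted_kernel K gam x y.
Proof.
move=> Xx Xy; have [Dx Dy] := (weighted_domain_box Xx, weighted_domain_box Xy).
(* the weighted kernel is defined as a difference of two sums of
   nonnegative terms *)
pose pos (u : {fset nat}) : R := Num.max (coord_kernel K u x y) 0.
pose neg (u : {fset nat}) : R := Num.max (- coord_kernel K u x y) 0.
have pos0 u : 0 <= pos u by rewrite le_max lexx orbT.
have neg0 u : 0 <= neg u by rewrite le_max lexx orbT.
have posneg (u : {fset nat}) : coord_kernel K u x y = pos u - neg u.
  rewrite /pos /neg; have /orP[h|h] := le_total 0 (coord_kernel K u x y).
    by rewrite (@max_l _ _ _ 0)// (@max_r _ _ _ 0) ?oppr_le0// subr0.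
  by rewrite (@max_r _ _ _ 0)// (@max_l _ _ _ 0) ?oppr_ge0// sub0r opprK.
have ple i : w i * pos (U i) <= w i * (k i x x + k i y y).
  rewrite ler_wpM2l// ge_max addr_ge0 ?k_ge0// andbT.
  by rewrite (le_trans (ler_norm _))//; exact: (norm_coord_kernel_le hK).
have nle i : w i * neg (U i) <= w i * (k i x x + k i y y).
  rewrite ler_wpM2l// ge_max addr_ge0 ?k_ge0// andbT.
  by rewrite (le_trans (ler_norm _))// normrN; exact: (norm_coord_kernel_le hK).
have fin f : (forall i, 0 <= f i) -> (forall i, f i <= w i * (k i x x + k i y y)) ->
    (\sum_(0 <= i <oo) (f i)%:E < +oo)%E.
  move=> f0 fle; apply: le_lt_trans (pairs_summable Xx Xy).
  by apply: lee_nneseries => [i _ _|i _]; rewrite lee_fin.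
have pfin := fin _ (fun i => mulr_ge0 (w0 i) (pos0 (U i))) ple.
have nfin := fin _ (fun i => mulr_ge0 (w0 i) (neg0 (U i))) nle.
have -> : weighted_kernel K gam x y =
    fine (\sum_(0 <= i <oo) (w i * pos (U i))%:E)%E -
    fine (\sum_(0 <= i <oo) (w i * neg (U i))%:E)%E.
  rewrite /weighted_kernel -fineB; first last.
  - by rewrite ge0_fin_numE//; apply: nneseries_ge0 => i _ _; rewrite lee_fin mulr_ge0.
  - by rewrite ge0_fin_numE//; apply: nneseries_ge0 => i _ _; rewrite lee_fin mulr_ge0.
  rewrite -!esum_enum//; congr (fine (_ - _)%E); apply: eq_esum => u _.
    by rewrite funeposE -EFin_max /pos maxr_pMr// mulr0.
  by rewrite funenegE -EFinN -EFin_max /neg maxr_pMr// mulr0 mulrN.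
have -> : (fun n => partial_kernel n x y) = (fun n =>
    \sum_(i < n) w i * pos (U i) - \sum_(i < n) w i * neg (U i)).
  apply/funext => n; rewrite -sumrB; apply: eq_bigr => i _.
  by rewrite -mulrBr -posneg.
by apply: cvgB; apply: nneseries_cvg_fine => // i; rewrite mulr_ge0.
Qed.

Lemma weighted_kernel_diag x : X x -> weighted_kernel K gam x x = diag_sum x.
Proof.
move=> Xx; have Dx := weighted_domain_box Xx.
apply: cvg_unique (partial_kernel_cvg Xx Xx) _ => //.
apply: (@nneseries_cvg_fine R (fun i => w i * k i x x)); last exact: X_fin.
by move=> i; rewrite mulr_ge0// k_ge0.
Qed.

Lemma measurable_partial_kernel n y : X y ->
  measurable_fun X (fun x => partial_kernel n x y).
Proof.
move=> Xy; apply: measurable_sum => i; apply: measurable_funM => //.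
apply: measurable_funS (measurable_box mD) weighted_domain_box _.
exact: measurable_coord_kernel (weighted_domain_box Xy).
Qed.

Lemma measurable_weighted_kernel y : X y ->
  measurable_fun X (fun x => weighted_kernel K gam x y).
Proof.
move=> Xy; apply: (@measurable_fun_cvg _ _ _ _ (fun n x => partial_kernel n x y)).
  by move=> n; exact: measurable_partial_kernel.
by move=> x Xx; exact: partial_kernel_cvg.
Qed.

Lemma integrable_weighted_kernel_diag :
  mu.-integrable X (fun x => (weighted_kernel K gam x x)%:E).
Proof.
apply: eq_integrable integrable_diag_sum; first exact: measurable_weighted_domain.
by move=> x; rewrite inE => Xx /=; rewrite weighted_kernel_diag.
Qed.

End weighted_space.

Section weighted_error.
Context {R : realType} (D : set R) (c : R) (K : R -> R -> R).
Hypothesis hK : is_anchored_kernel D c K.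
Hypothesis mD : measurable D.
Variable rho : probability R R.
Hypothesis rhoD : rho D = 1%E.
Hypothesis hM : (diag_integral D K rho < +oo)%E.
Variable mu : probability (coords R nat) R.
Hypothesis hmu : is_product_measure rho mu.
Variables (gam : {fset nat} -> R) (U : nat -> {fset nat}) (w : nat -> R).
Hypothesis gam0 : forall u, 0 <= gam u.
Hypothesis w0 : forall i, 0 <= w i.
Hypothesis esum_enum : forall k : {fset nat} -> R, (forall u, 0 <= k u) ->
  (\esum_(u in active gam) (gam u * k u)%:E =
   \sum_(0 <= i <oo) (w i * k (U i))%:E)%E.
Hypothesis weights_summable :
  (\sum_(0 <= i <oo) (w i * fine (diag_integral D K rho) ^+ #|` U i|)%:E < +oo)%E.
Variable Q : sampling R (coords R nat).

Let X := weighted_domain D K gam.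
Hypothesis QX : forall p, p \in Q -> X p.2.

Let mX : measurable X := measurable_weighted_domain hK mD rhoD hM hmu w0 esum_enum.
Let muX : mu X = 1%E :=
  measure_weighted_domain hK mD rhoD hM hmu w0 esum_enum weights_summable.
Let XD : X `<=` box D := @weighted_domain_box R D K gam.
Let e i x := error_functional mu X Q (fun y => coord_kernel K (U i) y x).
Let B := diag_sum K U w.

Let iB : mu.-integrable X (EFin \o B) :=
  integrable_diag_sum hK mD rhoD hM hmu w0 esum_enum weights_summable.

Let integrable_k i x : X x ->
  mu.-integrable X (EFin \o (fun y => coord_kernel K (U i) y x)).
Proof.
move=> Xx.
exact: (integral_coord_kernel hK mD hM hmu mX XD muX (fset_uniq (U i)) (XD Xx)).1.
Qed.

Let integrable_e i : mu.-integrable X (EFin \o e i).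
Proof.
pose g x := \prod_(j <- U i) kernel_mean D K rho (x j) -
  \sum_(p <- Q | p \in Q) p.1 * coord_kernel K (U i) x p.2.
have ig : mu.-integrable X (EFin \o g).
  rewrite (_ : EFin \o g =
      (fun x => (\prod_(j <- U i) kernel_mean D K rho (x j))%:E -
       \sum_(p <- Q | p \in Q) p.1%:E * (coord_kernel K (U i) x p.2)%:E)%E); last first.
    apply/funext => x /=; rewrite EFinB -sumEFin.
    by congr (_ - _)%E; apply: eq_bigr => p _; rewrite EFinM.
  apply: integrableB => //.
    exact: (integral_prod_kernel_mean hK mD hM hmu mX XD muX (fset_uniq (U i))).1.
  by apply: integrable_sum => // p pQ; apply: integrableZl => //; exact: integrable_k (QX pQ).
apply: eq_integrable ig => // x; rewrite inE => Xx /=; congr EFin.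
rewrite /e /error_functional /g /apply_sampling -big_seq; congr (_ - _).
  apply: esym.
  exact: (integral_coord_kernel hK mD hM hmu mX XD muX (fset_uniq (U i)) (XD Xx)).2.
apply: eq_big_seq => p pQ; congr (_ * _).
by apply: (coord_kernel_sym hK); [exact: XD|apply: XD; exact: QX].
Qed.

Let error_boundD r : error_bound mu X Q (fun y => B y + r) =
  error_bound mu X Q B + r * (1 + \sum_(p <- Q) `|p.1|).
Proof.
rewrite /error_bound RintegralD//; last exact: finite_measure_integrable_cst.
rewrite Rintegral_cst// [X in r * fine X]muX mulr1.
under eq_bigr do rewrite mulrDr.
rewrite big_split/= -mulr_suml; ring.
Qed.

(** Dominated convergence, once in each argument of the kernel: the partial
    sums of the kernel at (x,y) are at most B(x) + B(y) in absolute value, where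
    B is the integrable diagonal of the kernel. *)
Lemma sqr_error_weighted :
  (fun n => \sum_(i < n) w i * sqr_error mu X (coord_kernel K (U i)) Q) @ \oo -->
  sqr_error mu X (weighted_kernel K gam) Q.
Proof.
pose E n x := error_functional mu X Q (fun y => partial_kernel K U w n y x).
have EE n x : X x -> E n x = \sum_(i < n) w i * e i x.
  move=> Xx; apply: (@error_functional_sum _ _ _ mu X mX Q QX w
    (fun i y => coord_kernel K (U i) y x)) => i; exact: integrable_k.
have iBr r : mu.-integrable X (EFin \o (fun y => B y + r)).
  have -> : EFin \o (fun y => B y + r) = (fun y => (EFin \o B) y + (cst r y)%:E)%E.
    by apply/funext => y /=; rewrite EFinD.
  by apply: integrableD => //; exact: finite_measure_integrable_cst.
have mpk n x : X x -> measurable_fun X (fun y => partial_kernel K U w n y x).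
  exact: (measurable_partial_kernel hK mD).
have npk n x y : X x -> X y -> `|partial_kernel K U w n y x| <= B y + B x.
  move=> Xx Xy; exact: (norm_partial_kernel_le hK w0 esum_enum).
have mE n : measurable_fun X (E n).
  apply: (@eq_measurable_fun _ _ _ _ _ (fun x => \sum_(i < n) w i * e i x)).
    by move=> x; rewrite inE => Xx; rewrite EE.
  apply: measurable_sum => i; apply: measurable_funM => //.
  by apply/measurable_EFinP; exact: (measurable_int _ (integrable_e i)).
have -> : (fun n => \sum_(i < n) w i * sqr_error mu X (coord_kernel K (U i)) Q) =
    (fun n => error_functional mu X Q (E n)).
  apply/funext => n; rewrite -(@error_functional_sum _ _ _ mu X mX Q QX w e)//.
  by apply: eq_error_functional => // x Xx; rewrite EE.
pose b x := B x * (1 + \sum_(p <- Q) `|p.1|) + error_bound mu X Q B.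
apply: (@error_functional_cvg _ _ _ mu X mX Q QX _ _ b) => //.
- move=> x Xx; apply: (@error_functional_cvg _ _ _ mu X mX Q QX _ _ (fun y => B y + B x)).
  + by move=> n; exact: mpk.
  + by move=> y Xy; exact: (partial_kernel_cvg hK gam0 w0 esum_enum).
  + by move=> n y Xy; exact: npk.
  + exact: iBr.
- move=> n x Xx; rewrite /b addrC -error_boundD.
  by apply: norm_error_functional_le => //; [exact: mpk|move=> y Xy; exact: npk].
- have -> : EFin \o b = (fun x => ((1 + \sum_(p <- Q) `|p.1|)%:E * (EFin \o B) x) +
      (cst (error_bound mu X Q B) x)%:E)%E.
    by apply/funext => x /=; rewrite /b mulrC EFinD EFinM.
  apply: integrableD => //; first exact: integrableZl.
  exact: finite_measure_integrable_cst.
Qed.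

End weighted_error.

(** * Relabelling the coordinates of a lifted quadrature *)

Section error_transport.
Context {R : realType} {d1 d2} {T1 : measurableType d1} {T2 : measurableType d2}.
Variables (m1 : probability T1 R) (m2 : probability T2 R) (f : T1 -> T2).
Hypothesis mf : measurable_fun setT f.
Hypothesis m2E : forall A, measurable A -> m2 A = m1 (f @^-1` A).
Variables (X1 : set T1) (X2 : set T2).
Hypotheses (mX1 : measurable X1) (mX2 : measurable X2).
Hypothesis fX : forall x, X1 x -> X2 (f x).
Hypothesis m1X1 : m1 X1 = 1%E.
Variables (Q1 : sampling R T1) (Q2 : sampling R T2).
Hypothesis Q1X : forall p, p \in Q1 -> X1 p.2.
Hypothesis Q2E : Q2 = [seq (p.1, f p.2) | p <- Q1].

Lemma error_functional_transport g : measurable_fun X2 g ->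
  error_functional m2 X2 Q2 g = error_functional m1 X1 Q1 (g \o f).
Proof.
move=> mg; rewrite /error_functional; congr (_ - _); last first.
  by rewrite /apply_sampling Q2E big_map.
rewrite /Rintegral; congr fine.
have mfX : measurable (f @^-1` X2).
  by rewrite -[X in measurable X]setTI; exact: mf.
have mEg : measurable_fun X2 (EFin \o g) by exact/measurable_EFinP.
transitivity (\int[m1]_(x in f @^-1` X2) (g (f x))%:E)%E.
  exact: (integral_transport mf m2E mX2 mEg).
rewrite -(integral_full_measure mX1 mfX fX m1X1)//.
apply: (@measurable_comp _ _ _ _ _ _ X2 (EFin \o g) _ f) => //.
  by move=> _ [x ? <-].
exact: measurable_funTS.
Qed.

(** As a function of x, the error on the section at x is the representer of the
    error functional; being an element of the space, it is measurable. *)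
Lemma measurable_error_section (K : T2 -> T2 -> R) (H : rkhs X2 K) :
  (forall x, X2 x -> measurable_fun X2 (fun y => K y x)) ->
  m2.-integrable X2 (fun x => (K x x)%:E) ->
  (forall p, p \in Q2 -> X2 p.2) ->
  measurable_fun X2 (fun x => error_functional m2 X2 Q2 (fun y => K y x)).
Proof.
move=> mK iK Q2X; have [h hE] := error_representer mX2 H mK iK Q2X.
apply: (@eq_measurable_fun _ _ _ _ _ (rkhs_eval h)).
  move=> x; rewrite inE => Xx; rewrite eval_dot// hE.
  by apply: eq_error_functional => // y Xy; rewrite rkhs_sectionE.
exact: measurable_eval.
Qed.

Lemma sqr_error_transport (K1 : T1 -> T1 -> R) (K2 : T2 -> T2 -> R)
    (H : rkhs X2 K2) :
  (forall x y, X1 x -> X1 y -> K1 x y = K2 (f x) (f y)) ->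
  (forall x, X2 x -> measurable_fun X2 (fun y => K2 y x)) ->
  m2.-integrable X2 (fun x => (K2 x x)%:E) ->
  sqr_error m1 X1 K1 Q1 = sqr_error m2 X2 K2 Q2.
Proof.
move=> K12 mK iK.
have Q2X p : p \in Q2 -> X2 p.2.
  by rewrite Q2E => /mapP[q qQ ->]/=; apply: fX; exact: Q1X.
rewrite /sqr_error error_functional_transport; last exact: (measurable_error_section H).
apply: eq_error_functional => // x Xx /=.
rewrite error_functional_transport; last by apply: mK; exact: fX.
by apply: eq_error_functional => // y Xy /=; rewrite K12.
Qed.

End error_transport.

Section projection.
Context {R : realType} (d : nat) (phi : nat -> 'I_d) (u : {fset nat}).
Hypothesis phi_inj : {in u &, injective phi}.

Definition image_set : {set 'I_d} := finset (fun j => has (fun i => phi i == j) u).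

(** The inverse of [phi] on [u]; the default value of [nth] is never
    reached. *)
Definition preimage_coord (j : {j | j \in image_set}) : nat :=
  nth 0%N u (find (fun i => phi i == val j) u).

Lemma preimage_coord_mem j : preimage_coord j \in u.
Proof.
case: j => j jE; rewrite /preimage_coord /=; apply: mem_nth; rewrite -has_find.
by move: jE; rewrite finset.inE.
Qed.

Lemma preimage_coordK j : phi (preimage_coord j) = val j.
Proof.
case: j => j jE; rewrite /preimage_coord /=; apply/eqP.
have h : has (fun i => phi i == j) u by move: jE; rewrite finset.inE.
exact: (nth_find 0%N h).
Qed.

Lemma preimage_coord_inj : injective preimage_coord.
Proof.
by move=> j j' jj'; apply: val_inj; rewrite /= -!preimage_coordK jj'.
Qed.

Lemma perm_preimage_coord :
  perm_eq u [seq preimage_coord j | j <- index_enum {j | j \in image_set}].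
Proof.
apply: uniq_perm; first exact: fset_uniq.
  by rewrite map_inj_uniq ?index_enum_uniq//; exact: preimage_coord_inj.
move=> i; apply/idP/mapP => [iu|[j _ ->]]; last exact: preimage_coord_mem.
have iE : phi i \in image_set.
  by rewrite finset.inE; apply/hasP; exists i.
exists (exist _ (phi i) iE); first exact: mem_index_enum.
by apply: phi_inj => //; [exact: preimage_coord_mem|rewrite preimage_coordK].
Qed.

Lemma card_image_set : #|image_set| = #|` u|.
Proof.
rewrite (perm_size perm_preimage_coord) size_map -card_sig cardT enumT.
by [].
Qed.

Lemma coord_kernel_projection (K : R -> R -> R) (x y : coords R nat) :
  coord_kernel K u x y =
  tensor_kernel K (reindex preimage_coord x) (reindex preimage_coord y).
Proof.
by rewrite /coord_kernel (perm_big _ perm_preimage_coord) big_map.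
Qed.

Lemma quadrature_projection (a : forall n, 'I_n -> R)
    (t : forall n, 'I_n -> coords R 'I_d) (c : R) n (v : {fset nat}) :
  (u `<=` v)%fset ->
  quadrature_proj a t n image_set =
  [seq (p.1, reindex preimage_coord p.2) | p <- quadrature_lift a t c phi n v].
Proof.
move=> /fsubsetP uv; rewrite /quadrature_proj /quadrature_lift -map_comp.
apply: eq_map => i /=; congr (_, _); apply/funext => j.
by rewrite /reindex /anchor_at uv ?preimage_coord_mem// preimage_coordK.
Qed.

End projection.

Section lifted_quadrature_error.
Context {R : realType} (D : set R) (c : R) (K : R -> R -> R).
Hypothesis hK : is_anchored_kernel D c K.
Hypothesis mD : measurable D.
Variable rho : probability R R.
Hypothesis rhoD : rho D = 1%E.
Hypothesis hM : (diag_integral D K rho < +oo)%E.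
Variable mu : probability (coords R nat) R.
Hypothesis hmu : is_product_measure rho mu.
Variable X : set (coords R nat).
Hypotheses (mX : measurable X) (XD : X `<=` box D) (muX : mu X = 1%E).

(** The coordinates in [u] are relabelled by [phi]; this turns the product
    measure on D^N into the one on D^(phi(u)), the kernel of [u] into the one
    of [phi(u)], and the lifted quadrature into the projected one. *)
Lemma sqr_error_lift (d : nat) (phi : nat -> 'I_d) (u v : {fset nat})
    (a : forall n, 'I_n -> R) (t : forall n, 'I_n -> coords R 'I_d) (n : nat)
    (nu : probability (coords R {j | j \in image_set phi u}) R)
    (H : rkhs (box D) (@tensor_kernel R {j | j \in image_set phi u} K)) (e : R) :
  {in u &, injective phi} -> (u `<=` v)%fset ->
  is_product_measure rho nu ->
  (forall p, p \in quadrature_lift a t c phi n v -> X p.2) -> 0 <= e ->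
  (worst_case_error nu H (quadrature_proj a t n (image_set phi u)) <= e%:E)%E ->
  sqr_error mu X (coord_kernel K u) (quadrature_lift a t c phi n v) <= e ^+ 2.
Proof.
move=> phi_inj uv hnu QX e0.
pose sigma := @preimage_coord d phi u.
have mB : measurable (@box R {j | j \in image_set phi u} D) by exact: measurable_box.
have nuB : nu (box D) = 1%E by exact: measure_box hnu.
have mK (z : coords R {j | j \in image_set phi u}) : box D z ->
    measurable_fun (box D) (fun y => tensor_kernel K y z).
  move=> Dz; apply/measurable_EFinP; apply: (measurable_int nu).
  exact: (integral_coord_kernel hK mD hM hnu mB (@subset_refl _ _) nuB
    (index_enum_uniq _) Dz).1.
have iK : nu.-integrable (box D) (fun z => (tensor_kernel K z z)%:E).
  exact: (integral_coord_kernel_diag hK mD hM hnu mB (@subset_refl _ _) nuB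
    (index_enum_uniq _)).1.
have fX x : X x -> box D (reindex sigma x) by move=> /XD Dx j; exact: Dx.
rewrite (sqr_error_transport (@measurable_reindex R _ _ sigma)
  (product_measure_reindex (@preimage_coord_inj d phi u) hmu hnu) mX mB fX muX QX
  (quadrature_projection phi a t c n uv) H) //; last first.
  by move=> x y _ _; exact: coord_kernel_projection.
have QB p : p \in quadrature_proj a t n (image_set phi u) -> box D p.2.
  rewrite (quadrature_projection phi a t c n uv) => /mapP[q /QX Xq ->]/=; exact: fX.
have [s0 ->] := worst_case_errorE mB H mK iK QB.
rewrite lee_fin -[X in _ -> X <= _](sqr_sqrtr s0) => h.
by rewrite ler_pXn2r ?nnegrE ?sqrtr_ge0.
Qed.

End lifted_quadrature_error.

(** * The multilevel algorithm on one component *)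

Section multilevel_algorithm.
Context {R : realType} (D : set R) (c : R).
Hypothesis Dc : D c.
Context (d : nat) (phi : nat -> 'I_d) (a : forall n, 'I_n -> R).
Variable t : forall n, 'I_n -> coords R 'I_d.
Hypothesis ht : forall n (i : 'I_n), box D (t i).
Variables (vs : nat -> {fset nat}) (m : nat) (ns : nat -> nat).
Hypothesis vs0 : vs 0%N = fset0.
Hypothesis vs_mono : forall k l, (k <= l)%N -> (vs k `<=` vs l)%fset.

Local Notation Q := (multilevel a t c phi vs m ns).
Local Notation Qlift k := (quadrature_lift a t c phi (ns k) (vs k)).

Lemma box_anchor v (x : coords R nat) : box D x -> box D (anchor_at c v x).
Proof. by move=> Dx j; rewrite /anchor_at; case: ifP. Qed.

Lemma quadrature_lift_node n v p : p \in quadrature_lift a t c phi n v ->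
  exists2 z, box D z & p.2 = anchor_at c v z.
Proof.
move=> /mapP[i _ ->]/=; exists (fun j => t i (phi j)) => // j.
exact: (ht i).
Qed.

Lemma difference_node v v' (A : sampling R (coords R nat)) p :
  (forall q, q \in A -> exists2 z, box D z & q.2 = anchor_at c v' z) ->
  p \in difference c v A -> exists2 z, box D z & p.2 = anchor_at c v' z.
Proof.
move=> Anode /flattenP[_ /mapP[q qA ->]].
have [z Dz qz] := Anode q qA; rewrite !inE => /orP[/eqP ->|/eqP ->]/=.
  by exists z.
rewrite qz; exists (anchor_at c v z); first exact: box_anchor.
apply/funext => j; rewrite /anchor_at; case: (j \in v) => //.
by rewrite if_same.
Qed.

Lemma multilevel_node p : p \in Q ->
  exists k z, [/\ (k <= m)%N, box D z & p.2 = anchor_at c (vs k) z].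
Proof.
rewrite /multilevel inE => /orP[/eqP ->|/flattenP[_ /mapP[k kin ->] pk]].
  exists 0%N, (fun=> c); split => //=.
  by apply/funext => j; rewrite /anchor_at; case: ifP.
move: kin; rewrite mem_iota add1n ltnS => /andP[k0 km].
have [z Dz pz] := difference_node (@quadrature_lift_node _ _) pk.
by exists k, z.
Qed.

Lemma admissible_multilevel : admissible D c Q.
Proof.
move=> p /multilevel_node[k [z [_ Dz pz]]].
have Dp := box_anchor (vs k) Dz; rewrite -pz in Dp.
exists [fset j in vs k | p.2 j != c]%fset, p.2; split.
  by move=> j; rewrite !inE /= => /andP[_ /eqP pj]; split => //; exact: Dp.
apply/funext => j; rewrite /anchor_at !inE/=.
case: (eqVneq (p.2 j) c) => [pj|_]; first by rewrite andbF.
rewrite andbT; case: ifPn => // jk; rewrite pz /anchor_at (negbTE jk).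
by [].
Qed.

(** What the algorithms see of a function of H_u: setting coordinates to the
    anchor either has no effect on its value or makes it zero. *)
Definition anchored_component (u : {fset nat}) (g : coords R nat -> R) :=
  forall v x, box D x ->
    g (anchor_at c v x) = if (u `<=` v)%fset then g x else 0.

Lemma apply_level u g k : anchored_component u g -> (0 < k)%N ->
  apply_sampling (Qlift k) (fun x => g x - Psi c (vs k.-1) g x) =
  if (u `<=` vs k.-1)%fset then 0
  else if (u `<=` vs k)%fset then apply_sampling (Qlift k) g else 0.
Proof.
move=> gu k0.
have node p : p \in Qlift k -> g p.2 - Psi c (vs k.-1) g p.2 =
    if (u `<=` vs k.-1)%fset then 0 else if (u `<=` vs k)%fset then g p.2 else 0.
  move=> /quadrature_lift_node[z Dz pz].
  rewrite /Psi gu; last by rewrite pz; exact: box_anchor.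
  case: ifPn => uv; first by rewrite subrr.
  by rewrite subr0 pz gu//; case: ifP.
rewrite /apply_sampling.
rewrite (eq_big_seq (fun p => p.1 * if (u `<=` vs k.-1)%fset then 0
  else if (u `<=` vs k)%fset then g p.2 else 0)); last first.
  by move=> p /node ->.
by do 2 (case: ifP => _; first by [rewrite big1// => p _; rewrite mulr0|]);
  rewrite big1// => p _; rewrite mulr0.
Qed.

Lemma anchored_component_origin u g : anchored_component u g -> u != fset0 ->
  g (fun=> c) = 0.
Proof.
move=> gu u0; have := gu fset0 (fun=> c) (fun=> Dc).
by rewrite fsubset0 (negbTE u0) => <-; congr g; apply/funext => j.
Qed.

(** All the levels before the first one that contains [u] see the value zero,
    and all the levels after it see no difference. *)
Lemma apply_multilevel_component u g k : anchored_component u g ->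
  u != fset0 -> (0 < k <= m)%N -> (u `<=` vs k)%fset ->
  ~~ (u `<=` vs k.-1)%fset ->
  apply_sampling Q g = apply_sampling (Qlift k) g.
Proof.
move=> gu u0 /andP[k0 km] uk uk1.
rewrite apply_multilevel (anchored_component_origin gu u0) add0r.
rewrite (@bigD1_seq _ _ _ _ _ k)/=; [|by rewrite mem_index_iota ltnS k0|exact: iota_uniq].
rewrite (apply_level gu)// (negbTE uk1) uk big1_seq ?addr0// => l /andP[lk].
rewrite mem_index_iota => /andP[l0 _]; rewrite (apply_level gu)//.
case: ifPn => // ul1; case: ifPn => // ul; exfalso.
move: lk; rewrite neq_ltn => /orP[lk|kl].
  by move/negP : uk1; apply; apply: fsubset_trans ul (vs_mono _); rewrite -ltnS prednK.
by move/negP : ul1; apply; apply: fsubset_trans uk (vs_mono _); rewrite -ltnS prednK.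
Qed.

Lemma apply_multilevel_outside u g : anchored_component u g ->
  ~~ (u `<=` vs m)%fset -> apply_sampling Q g = 0.
Proof.
move=> gu um; have u0 : u != fset0 by apply: contraNneq um => ->; exact: fsub0set.
rewrite apply_multilevel (anchored_component_origin gu u0) add0r.
rewrite big1_seq// => l /andP[_]; rewrite mem_index_iota ltnS => /andP[l0 lm].
rewrite (apply_level gu)//; case: ifPn => // ul1; case: ifPn => // ul; exfalso.
by move/negP : um; apply; apply: fsubset_trans ul (vs_mono _).
Qed.

Lemma apply_multilevel_cst (r : R) : apply_sampling Q (fun=> r) = r.
Proof.
rewrite apply_multilevel big1 ?addr0// => k _.
by rewrite /apply_sampling big1// => p _; rewrite /Psi subrr mulr0.
Qed.

Section errors.
Variable K : R -> R -> R.
Hypothesis hK : is_anchored_kernel D c K.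
Hypothesis mD : measurable D.
Variable rho : probability R R.
Hypothesis hM : (diag_integral D K rho < +oo)%E.
Variable mu : probability (coords R nat) R.
Hypothesis hmu : is_product_measure rho mu.
Variable X : set (coords R nat).
Hypotheses (mX : measurable X) (XD : X `<=` box D) (muX : mu X = 1%E).
Hypothesis Xanchor : forall v z, box D z -> X (anchor_at c v z).

Lemma multilevel_in p : p \in Q -> X p.2.
Proof. by move=> /multilevel_node[k [z [_ Dz ->]]]; exact: Xanchor. Qed.

Lemma coord_kernel_component u x : box D x ->
  anchored_component u (fun y => coord_kernel K u y x).
Proof.
move=> Dx v y Dy; case: ifPn => [/fsubsetP uv|].
  by apply: eq_big_seq => i iu; rewrite /anchor_at uv.
move=> /fsubsetPn[i iu iv].
rewrite (coord_kernel_sym hK)//; last exact: box_anchor.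
by apply: (coord_kernel_anchor hK Dx iu); rewrite /anchor_at (negbTE iv).
Qed.

(** The error functional acts on one argument of the kernel and leaves the
    dependence on the other one as it is. *)
Lemma error_section_component u (A : sampling R (coords R nat)) :
  (forall p, p \in A -> X p.2) ->
  anchored_component u
    (fun x => error_functional mu X A (fun y => coord_kernel K u y x)).
Proof.
move=> AX v x Dx; case: ifPn => [/fsubsetP uv|].
  apply: eq_error_functional => // y Xy.
  by apply: eq_big_seq => i iu; rewrite /anchor_at uv.
move=> /fsubsetPn[i iu iv].
rewrite (@eq_error_functional _ _ _ _ _ _ _ (fun=> 0))//.
  rewrite /error_functional /apply_sampling big1 ?subr0.
    by rewrite Rintegral_cst// mul0r.
  by move=> p _; rewrite mulr0.
move=> y Xy; apply: (coord_kernel_anchor hK (XD Xy) iu).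
by rewrite /anchor_at (negbTE iv).
Qed.

Lemma sqr_error_multilevel u k : u != fset0 -> (0 < k <= m)%N ->
  (u `<=` vs k)%fset -> ~~ (u `<=` vs k.-1)%fset ->
  sqr_error mu X (coord_kernel K u) Q = sqr_error mu X (coord_kernel K u) (Qlift k).
Proof.
move=> u0 km uk uk1.
have QlX p : p \in Qlift k -> X p.2.
  by move=> /quadrature_lift_node[z Dz ->]; exact: Xanchor.
have E g : anchored_component u g ->
    error_functional mu X Q g = error_functional mu X (Qlift k) g.
  by move=> gu; rewrite /error_functional (apply_multilevel_component gu u0 km uk uk1).
rewrite /sqr_error E; last exact: error_section_component multilevel_in.
apply: eq_error_functional => // x Xx.
by rewrite E//; apply: coord_kernel_component; exact: XD.
Qed.

Lemma sqr_error_multilevel_outside u : ~~ (u `<=` vs m)%fset ->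
  sqr_error mu X (coord_kernel K u) Q = double_integral D K rho ^+ #|` u|.
Proof.
move=> um.
have E g : anchored_component u g ->
    error_functional mu X Q g = \int[mu]_(x in X) g x.
  by move=> gu; rewrite /error_functional (apply_multilevel_outside gu um) subr0.
rewrite /sqr_error E; last exact: error_section_component multilevel_in.
rewrite -(integral_prod_kernel_mean hK mD hM hmu mX XD muX (fset_uniq u)).2.
apply: eq_Rintegral => x; rewrite inE => Xx.
rewrite E; last by apply: coord_kernel_component; exact: XD.
exact: (integral_coord_kernel hK mD hM hmu mX XD muX (fset_uniq u) (XD Xx)).2.
Qed.

Lemma sqr_error_multilevel_cst : sqr_error mu X (coord_kernel K fset0) Q = 0.
Proof.
have E (r : R) : error_functional mu X Q (fun=> r) = 0.
  by rewrite /error_functional apply_multilevel_cst Rintegral_cst// [X in r * fine X]muX mulr1 subrr.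
rewrite /sqr_error -[RHS](E 0); apply: eq_error_functional => [p|x Xx].
  exact: multilevel_in.
rewrite -[RHS](E 1); apply: eq_error_functional => [p|y Xy].
  exact: multilevel_in.
by rewrite /coord_kernel big_nil.
Qed.

End errors.

End multilevel_algorithm.

(** At an anchored point only the finitely many subsets of [v] contribute to
    the sum that defines the domain. *)
Lemma anchor_in_weighted_domain (R : realType) (D : set R) (c : R)
    (K : R -> R -> R) (gam : {fset nat} -> R) (v : {fset nat}) (z : coords R nat) :
  is_anchored_kernel D c K -> box D z ->
  weighted_domain D K gam (anchor_at c v z).
Proof.
move=> hK Dz; have Da := box_anchor (anchor_in hK) v Dz.
split => //=.
pose A := [set u : {fset nat} | active gam u /\ (u `<=` v)%fset].
have fA : finite_set A.
  apply: (@sub_finite_set _ _ [set` fpowerset v]); last exact: finite_fset.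
  by move=> u [_ uv] /=; rewrite fpowersetE.
have zero u : active gam u -> ~ A u ->
    (gam u * tensor_kernel_fset K u (anchor_at c v z) (anchor_at c v z))%:E = 0%E.
  move=> au nA; have /fsubsetPn[i iu iv] : ~~ (u `<=` v)%fset.
    by apply/negP => uv; apply: nA.
  rewrite [tensor_kernel_fset _ _ _ _](_ : _ = 0) ?mulr0//.
  by apply: (coord_kernel_anchor hK Da iu); rewrite /anchor_at (negbTE iv).
have a0 u : active gam u ->
    (0 <= (gam u * tensor_kernel_fset K u (anchor_at c v z) (anchor_at c v z))%:E)%E.
  move=> au; rewrite lee_fin mulr_ge0//; first exact: ltW.
  exact: (coord_kernel_diag_ge0 hK).
pose F u := (gam u * tensor_kernel_fset K u (anchor_at c v z) (anchor_at c v z))%:E.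
have -> : (\esum_(u in active gam) F u = \esum_(u in A) F u)%E.
  rewrite [RHS](esum_mkcondr _ [set u : {fset nat} | (u `<=` v)%fset] F).
  apply: eq_esum => u au; case: ifPn => // nv; apply: zero => // -[_ uv].
  by move/negP : nv; apply; rewrite inE.
rewrite esum_fset//; last by move=> u; rewrite inE => -[au _]; exact: a0.
by rewrite fsumEFin// ltry.
Qed.

(** * Power sums and the choice of the parameters *)

Section power_estimates.
Context {R : realType}.
Implicit Types (x y z : R).

Lemma powRE x y : 0 < x -> x `^ y = expR (y * ln x).
Proof. by move=> x0; rewrite /powR gt_eqF. Qed.

Lemma powR_ge1 x y : 1 <= x -> 0 <= y -> 1 <= x `^ y.
Proof. by move=> x1 y0; rewrite -[leLHS](powRr0 x); exact: ler_powR. Qed.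

Lemma powR_exprn x y n : 0 <= x -> (x `^ y) ^+ n = (x ^+ n) `^ y.
Proof.
by move=> x0; rewrite -(powR_mulrn _ (powR_ge0 _ _)) powRAC powR_mulrn.
Qed.

(** The discrete counterpart of integrating z^(- (t + 1)), from
    ln (1 + 1 / j) >= 1 / (j + 1) and exp z >= 1 + z. *)
Lemma powR_succ_le (t : R) (j : nat) : 0 < t -> (0 < j)%N ->
  j.+1%:R `^ (- (t + 1)) <= t^-1 * (j%:R `^ (- t) - j.+1%:R `^ (- t)) :> R.
Proof.
move=> t0 j0; have a0 : 0 < j%:R :> R by rewrite ltr0n.
have b0 : 0 < j.+1%:R :> R by rewrite ltr0n.
set aj : R := j%:R in a0 *; set b : R := j.+1%:R in b0 *.
have ba : aj = b - 1 by rewrite /aj /b -natr1 addrK.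
rewrite ler_pdivlMl//.
have -> : b `^ (- (t + 1)) = b `^ (- t) * b^-1.
  by rewrite opprD powRD ?(gt_eqF b0) ?implybT// (powR_inv1 (ltW b0)).
have lnle : b^-1 <= ln b - ln aj.
  have : ln (aj / b) <= aj / b - 1.
    have := @le_ln1Dx R (aj / b - 1); rewrite (addrC 1) subrK; apply.
    by rewrite ltrBDr addNr divr_gt0.
  rewrite ln_div ?posrE//.
  have -> : aj / b - 1 = - b^-1 by rewrite ba; field; rewrite gt_eqF.
  by rewrite lerNr opprB.
have -> : aj `^ (- t) = b `^ (- t) * expR (t * (ln b - ln aj)).
  by rewrite !powRE// -expRD; congr expR; ring.
rewrite -[X in _ <= _ - X]mulr1 -mulrBr mulrCA ler_wpM2l ?powR_ge0//.
rewrite lerBrDl (le_trans _ (expR_ge1Dx _))// lerD2l ler_wpM2l// ltW//.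
Qed.

Lemma powR_tail_sum (t : R) (n N : nat) : 0 < t -> (0 < n)%N ->
  \sum_(n <= j < N) j.+1%:R `^ (- (t + 1)) <= t^-1 * n%:R `^ (- t).
Proof.
move=> t0 n0; have [nN|Nn] := leqP n N; last first.
  by rewrite big_geq ?(ltnW Nn)// mulr_ge0 ?powR_ge0// invr_ge0 ltW.
apply: (@le_trans _ _ (\sum_(n <= j < N) t^-1 * (j%:R `^ (- t) - j.+1%:R `^ (- t)))).
  by apply: ler_sum_nat => j /andP[nj _]; exact: (powR_succ_le t0 (leq_trans n0 nj)).
rewrite -mulr_sumr ler_wpM2l ?invr_ge0 ?(ltW t0)//.
rewrite -[leLHS]opprK -sumrN.
under eq_bigr do rewrite opprB.
rewrite telescope_sumr// opprB lerBlDr lerDl; exact: powR_ge0.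
Qed.

(** The logarithm is absorbed by x^((al - al') / (beta + 1)); the exponent beta
    is raised to beta + 1 so that it can be divided by. *)
Lemma powR_log_le (al al' beta : R) : al' < al -> 0 <= beta ->
  exists2 A : R, 0 < A & forall x, 1 <= x ->
    x `^ (- al) * (1 + ln x) `^ beta <= A * x `^ (- al').
Proof.
move=> aal b0; pose b1 := beta + 1; pose de := al - al'.
have b10 : 0 < b1 by rewrite ltr_wpDl.
have de0 : 0 < de by rewrite subr_gt0.
have c0 : 0 < 1 + b1 / de by rewrite addr_gt0// divr_gt0.
exists ((1 + b1 / de) `^ b1); first exact: powR_gt0.
move=> x x1; have x0 : 0 < x := lt_le_trans ltr01 x1.
have ln0 := ln_ge0 x1.
have l1 : 1 <= 1 + ln x by rewrite lerDl.
have -> : x `^ (- al') = x `^ (- al) * x `^ de.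
  rewrite -powRD ?(gt_eqF x0) ?implybT//.
  by have -> : - al + de = - al' by rewrite /de; ring.
rewrite mulrCA ler_wpM2l ?powR_ge0//.
apply: (@le_trans _ _ ((1 + ln x) `^ b1)).
  by apply: ler_powR => //; rewrite lerDl.
have -> : x `^ de = (x `^ (de / b1)) `^ b1.
  by rewrite -powRrM divfK// gt_eqF.
rewrite -powRM ?powR_ge0 ?(ltW c0)//.
apply: ge0_ler_powR; rewrite ?nnegrE ?(ltW b10) ?mulr_ge0 ?powR_ge0 ?(ltW c0)//.
  exact: le_trans ler01 l1.
rewrite mulrDl mul1r; apply: lerD.
  by apply: powR_ge1 => //; rewrite divr_ge0// ltW.
have -> : ln x = b1 / de * ln (x `^ (de / b1)).
  by rewrite ln_powR; field; rewrite !gt_eqF.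
by rewrite ler_wpM2l ?divr_ge0 ?(ltW b10) ?(ltW de0)// ltW// ln_sublinear// powR_gt0.
Qed.

Lemma geometric_sum_le z m : 1 < z ->
  \sum_(1 <= k < m.+1) z ^+ k <= z / (z - 1) * z ^+ m.
Proof.
move=> z1; have z10 : 0 < z - 1 by rewrite subr_gt0.
have z0 : 0 < z := lt_trans ltr01 z1.
elim: m => [|m IH]; first by rewrite big_geq// mulr1 divr_ge0// ltW.
rewrite big_nat_recr//= (le_trans (lerD IH (lexx _)))// exprS.
have -> : z / (z - 1) * z ^+ m + z * z ^+ m = z / (z - 1) * (z * z ^+ m).
  by field; rewrite gt_eqF.
by [].
Qed.

Lemma geometric_sum_lt1 z m : 0 <= z -> z < 1 ->
  \sum_(1 <= k < m.+1) z ^+ k <= (1 - z)^-1.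
Proof.
move=> z0 z1; have z10 : 0 < 1 - z by rewrite subr_gt0.
rewrite -(mul1r (_^-1)) ler_pdivlMr//.
suff -> : (\sum_(1 <= k < m.+1) z ^+ k) * (1 - z) = z - z ^+ m.+1.
  by rewrite lerBlDr (le_trans (ltW z1))// lerDl exprn_ge0.
elim: m => [|m IH]; first by rewrite big_geq// mul0r expr1 subrr.
by rewrite big_nat_recr//= mulrDl IH !exprS; ring.
Qed.

Lemma expr_unbounded z (T : R) : 1 < z -> exists n, T <= z ^+ n.
Proof.
move=> z1; exists (Num.truncn (T / (z - 1))).+1.
have z10 : 0 < z - 1 by rewrite subr_gt0.
set n := _.+1.
have h : T < n%:R * (z - 1) by rewrite -ltr_pdivrMr// truncnS_gt.
have bern k : k%:R * (z - 1) <= z ^+ k - 1.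
  elim: k => [|k IH]; first by rewrite mul0r subrr.
  have zk : 1 <= z ^+ k by rewrite exprn_ege1// ltW.
  have -> : z ^+ k.+1 - 1 = z ^+ k - 1 + z ^+ k * (z - 1) by rewrite exprS; ring.
  by rewrite -natr1 mulrDl lerD// ler_wpM2r// ltW.
by rewrite (le_trans (ltW h))// (le_trans (bern n))// gerBl.
Qed.

(** The number of levels [m] is the least one for which the truncation error
    is small, and n_k is proportional to eps^(-p) x^(- p k / 2). Since
    y < x^(p/2), the first levels dominate the cost; since p al > 1, the last
    levels dominate the error. *)
Lemma multilevel_parameters (x y p al E G : R) :
  1 < x -> 1 <= y -> 0 < p -> 0 < al -> 1 < p * al -> y < x `^ (p / 2) ->
  0 <= E -> 0 <= G ->
  exists2 C : R, 0 <= C & forall eps : R, 0 < eps -> eps <= 1 ->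
  exists (m : nat) (ns : nat -> nat),
    [/\ (0 < m)%N, forall k, (0 < ns k)%N,
        forall k l, (k <= l)%N -> (ns l <= ns k)%N,
        \sum_(1 <= k < m.+1) E * x ^- k * (ns k).+1%:R `^ (- (2 * al)) +
          G * x ^- m <= eps ^+ 2 &
        \sum_(1 <= k < m.+1) (ns k)%:R * y ^+ k <= C * eps `^ (- p)].
Proof.
move=> x1 y1 p0 al0 pal yx E0 G0.
have x0 : 0 < x := lt_trans ltr01 x1.
(* up to constants, n_k is eps^(-p) r^(-k), and n_k^(-2 al) grows
   like (x z)^k *)
pose r := x `^ (p / 2); pose de := p * al - 1; pose z := x `^ de.
have de0 : 0 < de by rewrite subr_gt0.
have p20 : 0 < p / 2 by rewrite divr_gt0.
have r1 : 1 < r by exact: le_lt_trans y1 yx.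
have r0 : 0 < r := lt_trans ltr01 r1.
have z1 : 1 < z.
  by rewrite -[ltLHS](powRr0 x) /z !powRE// ltr_expR mul0r mulr_gt0// ln_gt0.
have z0 : 0 < z := lt_trans ltr01 z1.
have rz : r `^ (2 * al) = x * z.
  rewrite /r /z -powRrM.
  have -> : p / 2 * (2 * al) = 1 + de by rewrite /de; field.
  by rewrite powRD ?(gt_eqF x0) ?implybT// (powRr1 (ltW x0)).
pose G1 := G + 1.
have G10 : 0 < G1 by rewrite ltr_wpDl.
(* A / eps^2 will be the bound on x^m *)
pose A := 2 * G1 * x.
have A0 : 0 < A by rewrite !mulr_gt0.
pose B := E * (z / (z - 1)) * A `^ de.
have zz0 : 0 <= z / (z - 1) by rewrite divr_ge0 ?subr_ge0 ?(ltW z0) ?(ltW z1).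
have B0 : 0 <= B by rewrite mulr_ge0 ?powR_ge0// mulr_ge0.
have B1 : 0 < 2 * B + 1 by rewrite ltr_wpDl// mulr_ge0.
(* the factor ka of n_k makes the sum over the levels at most eps^2 / 2 *)
pose ka := (2 * B + 1) `^ (2 * al)^-1.
have ka0 : 0 < ka by exact: powR_gt0.
have al20 : 0 < 2 * al by rewrite mulr_gt0.
have kaE : ka `^ (- (2 * al)) = (2 * B + 1)^-1.
  by rewrite /ka -powRrM mulrN mulVf ?(gt_eqF al20)// (powR_inv1 (ltW B1)).
exists (ka / (1 - y / r) + r / (r - 1) * A `^ (p / 2)).
  have yr : 0 <= 1 - y / r by rewrite subr_ge0 ler_pdivrMr// mul1r ltW.
  have rr : 0 <= r / (r - 1) by rewrite divr_ge0 ?subr_ge0 ?(ltW r0) ?(ltW r1).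
  apply: addr_ge0; first exact: divr_ge0 (ltW ka0) yr.
  exact: mulr_ge0 rr (powR_ge0 _ _).
move=> eps e0 e1.
pose T := 2 * G1 / eps ^+ 2.
have T1 : 1 < T.
  rewrite /T ltr_pdivlMr ?exprn_gt0// mul1r.
  by apply: (le_lt_trans (exprn_ile1 2 (ltW e0) e1)); rewrite /G1; move: G0; clear; lra.
have T0 : 0 < T := lt_trans ltr01 T1.
have exT : exists n, T <= x ^+ n by exact: expr_unbounded.
case: (ex_minnP exT) => m Tm mmin.
have m0 : (0 < m)%N.
  by rewrite lt0n; apply/negP => /eqP m0; move: Tm; rewrite m0 expr0 leNgt T1.
(* as m is minimal, x^m exceeds T by at most a factor x *)
have xmT : x ^+ m <= A * eps `^ (-2).
  have : x ^+ m.-1 < T.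
    by rewrite ltNge; apply/negP => /mmin; rewrite leqNgt prednK// leqnn.
  move=> /ltW h; rewrite -(prednK m0) exprS powR_invn ?(ltW e0)//.
  apply: (le_trans (ler_wpM2l (ltW x0) h)).
  by rewrite /T /A le_eqVlt; apply/orP; left; apply/eqP; ring.
have xms s : 0 <= s -> (x `^ s) ^+ m <= A `^ s * eps `^ (- (2 * s)).
  move=> s0; rewrite (powR_exprn _ _ (ltW x0)) -mulNr powRrM.
  rewrite -(powRM _ (ltW A0) (powR_ge0 _ _)).
  apply: ge0_ler_powR => //; rewrite nnegrE; first exact: exprn_ge0 (ltW x0).
  exact: mulr_ge0 (ltW A0) (powR_ge0 _ _).
pose v k := ka * eps `^ (- p) * r ^- k.
have kae0 : 0 < ka * eps `^ (- p) := mulr_gt0 ka0 (powR_gt0 _ e0).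
have v0 k : 0 < v k by rewrite mulr_gt0// invr_gt0 exprn_gt0.
exists m, (fun k => (Num.truncn (v k)).+1); split => //.
- move=> k l kl; rewrite ltnS; apply: le_truncn.
  rewrite /v ler_wpM2l ?(ltW kae0)//.
  by rewrite lef_pV2 ?posrE ?exprn_gt0// ler_eXn2l.
- have -> : eps ^+ 2 = eps ^+ 2 / 2 + eps ^+ 2 / 2 by field.
  apply: lerD; last first.
    have : G * x ^- m <= G1 / T.
      by apply: ler_pM => //; [rewrite invr_ge0 exprn_ge0// ltW|rewrite lerDl|
        rewrite lef_pV2 ?posrE ?exprn_gt0].
    move/le_trans; apply; rewrite /T le_eqVlt; apply/orP; left; apply/eqP.
    by field; rewrite !gt_eqF.
  have coef0 : 0 <= E * (2 * B + 1)^-1 * eps `^ (2 * al * p).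
    by rewrite mulr_ge0 ?powR_ge0// mulr_ge0// invr_ge0 ltW.
  apply: (@le_trans _ _ (\sum_(1 <= k < m.+1)
      (E * (2 * B + 1)^-1 * eps `^ (2 * al * p)) * z ^+ k)).
    apply: ler_sum => k _.
    have : (Num.truncn (v k)).+2%:R `^ (- (2 * al)) <= v k `^ (- (2 * al)).
      rewrite !powRN lef_pV2 ?posrE ?powR_gt0//.
      apply: ge0_ler_powR; rewrite ?nnegrE ?(ltW al20) ?(ltW (v0 k))//.
      by rewrite (le_trans (ltW (truncnS_gt _)))// ler_nat.
    have -> : v k `^ (- (2 * al)) = (2 * B + 1)^-1 * eps `^ (2 * al * p) * (x * z) ^+ k.
      have rk0 : 0 <= r ^+ k := exprn_ge0 k (ltW r0).
      rewrite /v powRM ?(ltW kae0) ?invr_ge0// (powRM _ (ltW ka0) (powR_ge0 _ _)).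
      rewrite kaE -powRrM mulrNN (mulrC p) -rz; congr (_ * _).
      rewrite -(powR_inv1 rk0) -powRrM mulN1r opprK.
      by rewrite (powR_exprn _ _ (ltW r0)).
    move=> h; rewrite (le_trans (ler_wpM2l _ h))//.
      by rewrite mulr_ge0// invr_ge0 exprn_ge0// ltW.
    rewrite exprMn le_eqVlt; apply/orP; left; apply/eqP.
    by field; rewrite !gt_eqF// exprn_gt0.
  rewrite -mulr_sumr (le_trans (ler_wpM2l coef0 (geometric_sum_le m z1)))//.
  have := xms de (ltW de0); rewrite -/z => zm.
  apply: (@le_trans _ _ ((E * (2 * B + 1)^-1 * eps `^ (2 * al * p)) *
      (z / (z - 1) * (A `^ de * eps `^ (- (2 * de)))))).
    exact: (ler_wpM2l coef0 (ler_wpM2l zz0 zm)).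
  have -> : E / (2 * B + 1) * eps `^ (2 * al * p) *
      (z / (z - 1) * (A `^ de * eps `^ (- (2 * de)))) =
      B / (2 * B + 1) * (eps `^ (2 * al * p) * eps `^ (- (2 * de))).
    by rewrite /B; ring.
  rewrite -powRD ?(gt_eqF e0) ?implybT//.
  have -> : 2 * al * p + - (2 * de) = 2 by rewrite /de; ring.
  rewrite (powR_mulrn 2 (ltW e0)) mulrC ler_wpM2l ?exprn_ge0 ?(ltW e0)//.
  by rewrite ler_pdivrMr//; move: B0; clear; lra.
- apply: (@le_trans _ _ (\sum_(1 <= k < m.+1)
      (ka * eps `^ (- p) * (y / r) ^+ k + r ^+ k))).
    apply: ler_sum => k _.
    have : (Num.truncn (v k)).+1%:R <= v k + 1.
      by rewrite -natr1 lerD2r truncn_le// ltW.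
    move=> h; have yk0 : 0 <= y ^+ k by rewrite exprn_ge0// (le_trans ler01).
    rewrite (le_trans (ler_wpM2r yk0 h))// mulrDl mul1r; apply: lerD.
      by rewrite /v exprMn exprVn; rewrite le_eqVlt; apply/orP; left; apply/eqP; ring.
    by rewrite lerXn2r ?nnegrE ?(le_trans ler01 y1) ?(ltW r0)// ltW.
  rewrite big_split/= -mulr_sumr mulrDl; apply: lerD.
    rewrite [leRHS]mulrAC ler_wpM2l ?(ltW kae0)//.
    apply: geometric_sum_lt1; first by rewrite divr_ge0 ?(le_trans ler01 y1) ?(ltW r0).
    by rewrite ltr_pdivrMr// mul1r.
  rewrite (le_trans (geometric_sum_le m r1))// -[leRHS]mulrA ler_wpM2l//.
    by rewrite divr_ge0 ?subr_ge0 ?(ltW r0) ?(ltW r1).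
  have := xms (p / 2) (ltW p20).
  by have -> : 2 * (p / 2) = p by field.
Qed.

End power_estimates.

(** * The cost of nested subspace sampling *)

Section cost_of_nested_sampling.
Context {R : realType}.

(** Any finite increasing chain is part of a strictly increasing sequence:
    beyond the last set of the chain, labels larger than all of its elements
    are added one at a time. *)
Lemma nested_through (vs : nat -> {fset nat}) (m : nat) :
  vs 0%N = fset0 -> (forall k, (vs k `<=` vs k.+1)%fset) ->
  exists2 w, nested w & forall k, (k <= m)%N -> exists i, w i = vs k.
Proof.
move=> vs0 vsS.
pose fresh N k : {fset nat} := [fset x in iota N k]%fset.
have freshE N k x : (x \in fresh N k) = (N <= x < N + k)%N.
  by rewrite /fresh !inE /= mem_iota.
suff [w [n [wn _ wk]]] : exists w n, [/\ nested w, w n = vs m &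
    forall k, (k <= m)%N -> exists i, w i = vs k /\ (i <= n)%N].
  by exists w => // k /wk[i [wi _]]; exists i.
elim: m => [|m [w [n [wn wm wk]]]].
  exists (fresh 0%N), 0%N; split.
  - move=> i; rewrite fproperEneq; apply/andP; split.
      apply/eqP => /fsetP/(_ i); rewrite !freshE /= !add0n ltnn ltnS leqnn.
      by [].
    by apply/fsubsetP => x; rewrite !freshE !add0n /= => /ltnW; rewrite ltnS.
  - by rewrite vs0; apply/fsetP => x; rewrite freshE inE addn0 ltn0 andbF.
  - move=> k; rewrite leqn0 => /eqP ->; exists 0%N; split => //.
    by rewrite vs0; apply/fsetP => x; rewrite freshE inE addn0 ltn0 andbF.
have [vE|vN] := eqVneq (vs m.+1) (vs m).
  exists w, n; split => //; first by rewrite wm vE.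
  move=> k; rewrite leq_eqVlt => /orP[/eqP ->|]; last by rewrite ltnS; exact: wk.
  by exists n; rewrite wm vE.
pose N := (\max_(x <- vs m.+1) x)%N.+1.
have Nub x : x \in vs m.+1 -> (x < N)%N.
  by move=> xv; rewrite /N ltnS; exact: (@leq_bigmax_seq _ (enum_fset (vs m.+1)) xpredT (fun y => y) x xv isT).
pose w' i := if (i <= n)%N then w i else (vs m.+1 `|` fresh N (i - n.+1)%N)%fset.
have w'n1 : w' n.+1 = vs m.+1.
  rewrite /w' ltnn subnn; apply/fsetP => x; rewrite !inE /=.
  by rewrite orbF.
exists w', n.+1; split => //.
- move=> i; have [lt_in|ge_in] := ltnP i n.
    by rewrite /w' (ltnW lt_in) lt_in; exact: wn.
  move: ge_in; rewrite leq_eqVlt => /orP[/eqP <-|lt_ni].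
    rewrite w'n1 /w' leqnn wm fproperEneq eq_sym vN; exact: vsS.
  have h1 : (i <= n)%N = false by rewrite leqNgt lt_ni.
  have h2 : (i < n)%N = false by rewrite ltnNge ltnW.
  rewrite /w' h1 h2.
  rewrite fproperEneq; apply/andP; split.
    apply/eqP => /fsetP/(_ (N + (i - n.+1))%N); rewrite !in_fsetU !freshE.
    rewrite leq_addr /= ltnn orbF subSS ltn_add2l -(subnSK lt_ni) ltnSn orbT.
    by move=> /Nub; rewrite ltnNge leq_addr.
  apply: fsetUS; apply/fsubsetP => x; rewrite !freshE => /andP[-> /=].
  by move=> /leq_trans; apply; rewrite leq_add2l leq_sub2r.
- move=> k; rewrite leq_eqVlt => /orP[/eqP ->|]; first by exists n.+1.
  rewrite ltnS => /wk[i [wi le_in]]; exists i; split; last exact: leqW.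
  by rewrite /w' le_in.
Qed.

Lemma ereal_sum_le_size (T : eqType) (s : seq T) (f : T -> \bar R) (r : R) :
  (forall p, p \in s -> (f p <= r%:E)%E) ->
  (\sum_(p <- s) f p <= ((size s)%:R * r)%:E)%E.
Proof.
elim: s => [_|p s IH fr]; first by rewrite big_nil mul0r.
rewrite big_cons /= -natr1 mulrDl mul1r EFinD [leLHS]addeC; apply: leeD.
  by apply: IH => q qs; apply: fr; rewrite inE qs orbT.
by apply: fr; rewrite inE eqxx.
Qed.

(** Every node of level k, and its projection to level k - 1, has only anchor
    coordinates outside v_k; and all v_k occur in one nested sequence. *)
Lemma cost_nest_multilevel_le (cost : nat -> R) (c : R) (d : nat)
    (phi : nat -> 'I_d) (a : forall n, 'I_n -> R)
    (t : forall n, 'I_n -> coords R 'I_d) (vs : nat -> {fset nat})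
    (m : nat) (ns : nat -> nat) :
  vs 0%N = fset0 -> (forall k, (vs k `<=` vs k.+1)%fset) ->
  (cost_nest cost c (multilevel a t c phi vs m ns) <=
   (cost 0%N + \sum_(1 <= k < m.+1) (2 * ns k)%:R * cost #|` vs k|)%:E)%E.
Proof.
move=> vs0 vsS; have [w wn wk] := @nested_through vs m vs0 vsS.
have pc k x : (k <= m)%N -> (forall j, j \notin vs k -> x j = c) ->
    (point_cost cost c w x <= (cost #|` vs k|)%:E)%E.
  move=> km xc; have [i wi] := wk k km.
  by apply: ereal_inf_lbound; exists i => /=; rewrite wi.
apply: (@le_trans _ _ (\sum_(p <- multilevel a t c phi vs m ns) point_cost cost c w p.2)%E).
  by apply: ereal_inf_lbound; exists w.
rewrite /multilevel big_cons EFinD; apply: leeD.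
  by have := pc 0%N (fun=> c) (leq0n _) (fun _ _ => erefl); rewrite vs0 cardfs0.
rewrite big_flatten big_map -sumEFin /index_iota subn1 /=.
rewrite big_seq [leRHS]big_seq; apply: lee_sum => k.
rewrite mem_iota add1n ltnS => /andP[k0 km].
apply: le_trans (@ereal_sum_le_size _ _ _ (cost #|` vs k|) _) _; last first.
  rewrite lee_fin le_eqVlt; apply/orP; left; apply/eqP; congr (_%:R * _).
  rewrite /difference size_flatten /shape -map_comp.
  rewrite (@eq_map _ _ _ (fun=> 2%N))// sumnE big_map big_const_seq count_predT.
  by rewrite iter_addn_0 /quadrature_lift size_map size_enum_ord mulnC.
move=> p /flattenP[_ /mapP[q qA ->]].
move: qA => /mapP[i _ ->]; rewrite !inE => /orP[/eqP ->|/eqP ->] /=; apply: pc => // j jk.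
  by rewrite /anchor_at (negbTE jk).
by rewrite /anchor_at (negbTE jk) if_same.
Qed.

Lemma cost_growth (cost : nat -> R) (s : R) : 0 <= s ->
  {homo cost : k l / (k <= l)%N >-> k <= l} ->
  cost =O_\oo (fun k : nat => k%:R `^ s) ->
  exists (A : R) (N : nat), [/\ 0 < A, (0 < N)%N &
    forall k, cost k <= A * (k + N)%:R `^ s].
Proof.
move=> s0 cmono /eqO_exP[A A0 [N _ HN]].
exists A, N.+1; split => // k.
apply: (le_trans (cmono _ _ (leq_addr N.+1 k))).
have Nk : (N <= k + N.+1)%N by rewrite addnS; apply: leqW; exact: leq_addl.
apply: (le_trans (ler_norm _)); apply: (le_trans (HN _ Nk)).
by rewrite ger0_norm// powR_ge0.
Qed.

End cost_of_nested_sampling.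

(** * Enumeration and decay of the weights *)

Section enumeration_of_weights.
Context {R : realType} (gam : {fset nat} -> R) (M C0 : R).
Hypothesis hgam : is_weights gam M.
Hypothesis M0 : 0 <= M.
Variable us : nat -> {fset nat}.
Hypothesis hus : is_weight_order gam C0 us.

(** The empty set comes first, since the sequence [us] lists the nonempty sets;
    where [us] is padded with the empty set, the weight is set to zero. *)
Definition enum_sets (i : nat) : {fset nat} := if i is j.+1 then us j else fset0.

Definition enum_weights (i : nat) : R :=
  if i is j.+1 then (if us j == fset0 then 0 else gam (us j)) else gam fset0.

Lemma enum_weights_ge0 i : 0 <= enum_weights i.
Proof.
by case: hgam => g0 _ _; case: i => [|j] /=; [exact: g0|case: ifP => // _; exact: g0].
Qed.

Lemma esum_enum_sets (k : {fset nat} -> R) : (forall u, 0 <= k u) ->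
  (\esum_(u in active gam) (gam u * k u)%:E =
   \sum_(0 <= i <oo) (enum_weights i * k (enum_sets i))%:E)%E.
Proof.
move=> k0; case: hgam => g0 _ _; case: hus => us_act us_surj us_inj _.
pose P := [set i | if i is j.+1 then us j != fset0 else 0 < gam fset0].
have -> : active gam = enum_sets @` P.
  apply/seteqP; split => u.
    move=> au; have [uE|u0] := eqVneq u fset0.
      by exists 0%N => //=; rewrite -?uE.
    by have [j uj] := us_surj u u0 au; exists j.+1 => //=; rewrite uj.
  by move=> [[|j] /= Pi <-] //; exact: us_act.
rewrite esum_set_image; first last.
- move=> [|i] [|j]; rewrite !inE /= => Pi Pj // E.
  + by rewrite -E eqxx in Pj.
  + by rewrite E eqxx in Pi.
  + by rewrite (us_inj i j).
- by move=> i _; rewrite lee_fin mulr_ge0.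
rewrite eseries_mkcond; apply: eq_eseriesr => i _.
case: (boolP (i \in P)); case: i => [|j]; rewrite /= ?inE ?notin_setE /=.
- by [].
- by move=> /negbTE ->.
- move=> /negP; rewrite -leNgt => h.
  by have -> : gam fset0 = 0; [apply/eqP; rewrite eq_le h g0|rewrite mul0r].
- by move=> /negP; rewrite negbK => ->; rewrite mul0r.
Qed.

Lemma enum_weights_summable :
  (\sum_(0 <= i <oo) (enum_weights i * M ^+ #|` enum_sets i|)%:E < +oo)%E.
Proof.
rewrite -(@esum_enum_sets (fun u => M ^+ #|` u|)); last first.
  by move=> u; rewrite exprn_ge0.
case: hgam => g0 hs _; apply: le_lt_trans hs; rewrite esum_mkcond.
apply: le_esum => u _; case: ifP => // _.
by rewrite lee_fin mulr_ge0// exprn_ge0.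
Qed.

End enumeration_of_weights.

Section levels.
Context {R : realType} (us : nat -> {fset nat}) (L : nat) (b : R).
Hypotheses (L0 : (0 < L)%N) (b1 : 1 < b).

Definition level_size (k : nat) : nat :=
  if k is k'.+1 then (L * `|Num.ceil (b ^+ k')|)%N else 0%N.

Let b0 : 0 < b := lt_trans ltr01 b1.
Let bk1 k : 1 <= b ^+ k. Proof. by rewrite exprn_ege1// ltW. Qed.

Let ceilE k : (`|Num.ceil (b ^+ k)|%N)%:R = (Num.ceil (b ^+ k))%:~R :> R.
Proof.
by rewrite natr_absz ger0_norm// -(ler_int R) (le_trans (le_trans ler01 (bk1 k)) (ceil_ge _)).
Qed.

Lemma level_size_ge k : b ^+ k <= (level_size k.+1)%:R.
Proof.
rewrite /= natrM ceilE (le_trans (ceil_ge (b ^+ k)))//.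
rewrite ler_peMl// ?ler1n//.
by rewrite (le_trans (le_trans ler01 (bk1 k)) (ceil_ge _)).
Qed.

Lemma level_size_le k : (level_size k)%:R <= (2 * L)%:R * b ^+ k.
Proof.
case: k => [|k]; first by rewrite mulr_ge0// exprn_ge0// ltW.
rewrite /= !natrM ceilE (mulrC 2) -mulrA ler_wpM2l//.
have h : (Num.ceil (b ^+ k))%:~R <= b ^+ k + 1 :> R.
  rewrite -lerBlDr; apply: ltW.
  by have := ceilB1_lt (b ^+ k); rewrite intrD.
rewrite (le_trans h)//.
have : b ^+ k <= b ^+ k.+1 by rewrite exprS ler_peMl ?exprn_ge0 ?(ltW b1)// ltW.
have := bk1 k.+1; lra.
Qed.

Lemma level_size_mono k l : (k <= l)%N -> (level_size k <= level_size l)%N.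
Proof.
case: k => // k; case: l => // l; rewrite ltnS => kl.
rewrite /= leq_pmul2l// -(ler_nat R) !ceilE ler_int; apply: le_ceil.
by rewrite ler_eXn2l.
Qed.

Lemma levelE k : level us L b k = \big[@fsetU nat/fset0]_(j < level_size k) us j.
Proof. by case: k => //=; rewrite big_ord0. Qed.

Lemma level_sup k j : (j < level_size k)%N -> (us j `<=` level us L b k)%fset.
Proof.
move=> jk; rewrite levelE.
exact: (@bigfcup_sup _ _ (index_enum _) (Ordinal jk) xpredT (fun i => us (val i))
  (mem_index_enum _) isT).
Qed.

Lemma level_mono k l : (k <= l)%N -> (level us L b k `<=` level us L b l)%fset.
Proof.
move=> kl; rewrite levelE; apply/bigfcupsP => j _ _.
apply: level_sup; exact: leq_trans (ltn_ord j) (level_size_mono kl).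
Qed.

Lemma card_level k n : (forall j, (#|` us j| <= n)%N) ->
  (#|` level us L b k| <= n * level_size k)%N.
Proof.
move=> usn; rewrite levelE.
elim: (level_size k) => [|l IH]; first by rewrite big_ord0 cardfs0.
rewrite big_ord_recr /= mulnS addnC.
apply: (leq_trans (_ : _ <= #|` \big[@fsetU nat/fset0]_(j < l) us j| + #|` us l|)%N).
  by rewrite cardfsU leq_subr.
by rewrite leq_add.
Qed.

Section tails.
Variables (h : nat -> R) (t G : R).
Hypotheses (t0 : 0 < t) (G0 : 0 <= G) (h0 : forall j, 0 <= h j).
Hypothesis hG : forall j, h j <= G * j.+1%:R `^ (- (t + 1)).

(** The factor b^t makes up for the shift from b^(k - 1) to b^k; the summand 1
    is for the first weight. *)
Definition tail_const : R := G * (1 + t^-1) * b `^ t.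

Lemma tail_const_ge0 : 0 <= tail_const.
Proof. by rewrite !mulr_ge0 ?powR_ge0// addr_ge0// invr_ge0 ltW. Qed.

(** The sum of the weights beyond the first n ones is of the order n^(- t), and
    the size of level k is at least b^(k - 1). The case k = 0, where all weights
    are summed, is reduced to n = 1. *)
Lemma tail_weights_le (k N : nat) :
  \sum_(j < N) (if (j < level_size k)%N then 0 else h j) <=
  tail_const * (b `^ t) ^- k.
Proof.
have bt1 : 1 <= b `^ t by rewrite powR_ge1// ltW.
have bt0 : 0 < b `^ t := lt_le_trans ltr01 bt1.
have key n : (0 < n)%N ->
    \sum_(j < N) (if (j < n)%N then 0 else h j) <= G * (t^-1 * n%:R `^ (- t)).
  move=> n0; have [Nn|nN] := leqP N n.
    rewrite big1; first by rewrite !mulr_ge0 ?powR_ge0// invr_ge0 ltW.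
    by move=> j _; rewrite (leq_trans (ltn_ord j) Nn).
  rewrite -(big_mkord xpredT (fun j => if (j < n)%N then 0 else h j)).
  rewrite (@big_cat_nat _ _ _ n)//=; last exact: ltnW.
  rewrite big1_seq ?add0r; last first.
    by move=> j /andP[_]; rewrite mem_index_iota => /andP[_ ->].
  apply: (@le_trans _ _ (\sum_(n <= j < N) G * j.+1%:R `^ (- (t + 1)))).
    by apply: ler_sum_nat => j /andP[nj _]; rewrite ltnNge nj; exact: hG.
  by rewrite -mulr_sumr ler_wpM2l// powR_tail_sum.
case: k => [|k].
  rewrite expr0 invr1 mulr1; apply: (@le_trans _ _ (G * (1 + t^-1))).
    apply: (@le_trans _ _ (h 0%N + \sum_(j < N) (if (j < 1)%N then 0 else h j))).
      case: N {key} => [|N]; first by rewrite !big_ord0 addr0.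
      by rewrite !big_ord_recl /= add0r lerD2l; apply: ler_sum => j _.
    rewrite mulrDr; apply: lerD.
      by rewrite (le_trans (hG 0))// powR1.
    by rewrite (le_trans (key 1%N isT))// powR1 mulr1.
  by rewrite ler_peMr// mulr_ge0// addr_ge0// invr_ge0 ltW.
have s1 := level_size_ge k.
have s0 : 0 < (level_size k.+1)%:R :> R by rewrite (lt_le_trans _ s1)// exprn_gt0.
apply: (le_trans (key _ _)); first by rewrite ltr0n in s0.
have -> : tail_const / b `^ t ^+ k.+1 = G * (1 + t^-1) * (b `^ t ^- k).
  by rewrite /tail_const exprS; field; rewrite !gt_eqF ?exprn_gt0.
rewrite mulrA; apply: ler_pM.
- by rewrite mulr_ge0// invr_ge0 ltW.
- exact: powR_ge0.
- by rewrite ler_wpM2l// lerDr.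
rewrite powRN lef_pV2 ?posrE ?exprn_gt0 ?powR_gt0//.
rewrite (powR_exprn _ _ (ltW b0)); apply: ge0_ler_powR => //; first exact: ltW.
- by rewrite nnegrE exprn_ge0// ltW.
- by rewrite nnegrE.
Qed.

End tails.

End levels.

Lemma decay_bound (R : realType) (gam : {fset nat} -> R) (C0 : R)
    (us : nat -> {fset nat}) (q : R) :
  (fun j => if us j == fset0 then 0
            else scaled_weight gam C0 (us j) * j.+1%:R `^ q) @ \oo --> (0 : R) ->
  exists2 G, 0 <= G & forall j,
    (if us j == fset0 then 0 else scaled_weight gam C0 (us j)) <=
      G * j.+1%:R `^ (- q).
Proof.
set f := fun j => _; move=> fc.
have [G [_ HG]] := cvg_seq_bounded (cvgP _ fc).
exists (`|G| + 1); first by rewrite addr_ge0.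
move=> j; have jq : 0 < j.+1%:R `^ q :> R by rewrite powR_gt0.
rewrite powRN ler_pdivlMr//.
have := HG (`|G| + 1) (le_lt_trans (ler_norm _) (ltr_pwDr ltr01 (lexx _))) j I.
rewrite /f /=; case: ifP => _ H; first by rewrite mul0r addr_ge0.
by apply: (le_trans (ler_norm _)); exact: H.
Qed.

(** The hypothesis on p says that the decay exceeds 1 + 2 s / p; any admissible
    rate t + 1 in between gives 2 s < p t. *)
Lemma decay_rate (R : realType) (gam : {fset nat} -> R) (C0 : R)
    (us : nat -> {fset nat}) (s p : R) : 0 <= s -> 0 < p ->
  (1 < decay gam C0 us)%E ->
  ((2 * s)%:E / (decay gam C0 us - 1) < p%:E)%E ->
  exists2 t, 0 < t & [/\ 2 * s < p * t &
    (fun j => if us j == fset0 then 0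
      else scaled_weight gam C0 (us j) * j.+1%:R `^ (t + 1)) @ \oo --> (0 : R)].
Proof.
move=> s0 p0 d1 sp.
have sp0 : 0 <= 2 * s / p by rewrite divr_ge0 ?mulr_ge0// ltW.
have : ((1 + 2 * s / p)%:E < decay gam C0 us)%E.
  move: d1 sp; case: (decay gam C0 us) => [r| |]//; last by move=> _ _; exact: ltry.
  rewrite lte_fin => r1; rewrite -EFinB inver ifF; last by rewrite subr_eq0 gt_eqF.
  rewrite -EFinM !lte_fin ltr_pdivrMr ?subr_gt0// => h.
  by rewrite -ltrBrDl ltr_pdivrMr// [ltRHS]mulrC.
move=> /ereal_sup_gt[_ [q qc <-]]; rewrite lte_fin => hq.
exists (q - 1).
  by rewrite subr_gt0 (le_lt_trans _ hq)// lerDl.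
split; first by rewrite [ltRHS]mulrC -ltr_pdivrMr// ltrBrDl.
by rewrite subrK.
Qed.

(** * The error of the multilevel algorithm *)

Section multilevel_error.
Context {R : realType} (D : set R) (c : R) (K : R -> R -> R).
Hypotheses (hK : is_anchored_kernel D c K) (mD : measurable D).
Variable rho : probability R R.
Hypotheses (rhoD : rho D = 1%E) (hM : (diag_integral D K rho < +oo)%E).
Hypothesis hC0 : 0 < double_integral D K rho.
Variable mu : probability (coords R nat) R.
Hypothesis hmu : is_product_measure rho mu.
Variable gam : {fset nat} -> R.
Hypothesis hgam : is_weights gam (fine (diag_integral D K rho)).
Variable us : nat -> {fset nat}.
Hypothesis hus : is_weight_order gam (double_integral D K rho) us.
Variables (d : nat) (phi : nat -> 'I_d).
Hypothesis phi_inj : forall u, active gam u -> {in u &, injective phi}.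
Variables (a : forall n, 'I_n -> R) (t : forall n, 'I_n -> coords R 'I_d).
Hypothesis ht : forall n (i : 'I_n), box D (t i).
Variable Hu : forall u : {set 'I_d}, rkhs (box D) (@tensor_kernel R {j | j \in u} K).
Variable rhou : forall u : {set 'I_d}, probability (coords R {j | j \in u}) R.
Hypothesis hrhou : forall u, is_product_measure rho (rhou u).
Variable e : nat -> R.
Hypothesis e0 : forall n, 0 <= e n.
Hypothesis herr : forall n, (0 < n)%N -> forall u : {set 'I_d},
  (worst_case_error (rhou u) (Hu u) (quadrature_proj a t n u) <= (e n)%:E)%E.
Variables (L : nat) (b : R).
Hypotheses (L0 : (0 < L)%N) (b1 : 1 < b).

Let X := weighted_domain D K gam.
Let C0 := double_integral D K rho.
Let M := fine (diag_integral D K rho).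
Let w := enum_weights gam us.
Let vs := level us L b.
Let h j := if us j == fset0 then 0 else scaled_weight gam C0 (us j).

Let M0 : 0 <= M.
Proof.
apply: fine_ge0; apply: integral_ge0 => x Dx.
by rewrite lee_fin (kernel_ge0 hK).
Qed.

Let gam0 u : 0 <= gam u. Proof. by case: hgam. Qed.
Let w0 i : 0 <= w i. Proof. exact: enum_weights_ge0 hgam us i. Qed.
Let esumE := esum_enum_sets hgam hus.
Let wsum := enum_weights_summable hgam M0 hus.

Lemma multilevel_domain_measurable : measurable X.
Proof. exact: (measurable_weighted_domain hK mD rhoD hM hmu w0 esumE). Qed.

Lemma multilevel_domain_full : mu X = 1%E.
Proof. exact: (measure_weighted_domain hK mD rhoD hM hmu w0 esumE wsum). Qed.

Lemma multilevel_section_measurable y : X y ->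
  measurable_fun X (fun x => weighted_kernel K gam x y).
Proof. exact: (measurable_weighted_kernel hK mD gam0 w0 esumE). Qed.

Lemma multilevel_diag_integrable :
  mu.-integrable X (fun x => (weighted_kernel K gam x x)%:E).
Proof.
exact: (integrable_weighted_kernel_diag hK mD rhoD hM hmu gam0 w0 esumE wsum).
Qed.

Lemma card_active u : active gam u -> (#|` u| <= d)%N.
Proof.
move=> /phi_inj pu; rewrite -(card_image_set pu).
by rewrite (leq_trans (max_card _))// card_ord.
Qed.

Lemma card_us j : (#|` us j| <= d)%N.
Proof.
have [->|u0] := eqVneq (us j) fset0; first by rewrite cardfs0.
by apply: card_active; case: hus => + _ _ _; apply.
Qed.

Lemma scaled_weight_ge0 j : 0 <= h j.
Proof.
rewrite /h; case: ifP => // _.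
by rewrite /scaled_weight mulr_ge0// exprn_ge0// ltW.
Qed.

(** As the active sets have at most d elements, the weights and the scaled
    weights are comparable. *)
Lemma weight_le_scaled j : us j != fset0 -> gam (us j) <= (1 + C0^-1) ^+ d * h j.
Proof.
move=> u0; rewrite /h (negbTE u0) /scaled_weight.
have C1 : 1 <= 1 + C0^-1 by rewrite lerDl invr_ge0 ltW.
have -> : (1 + C0^-1) ^+ d * (gam (us j) * C0 ^+ #|` us j|) =
    gam (us j) * ((1 + C0^-1) ^+ d * C0 ^+ #|` us j|) by ring.
rewrite ler_peMr// -ler_pdivrMr ?exprn_gt0// mul1r -exprVn.
apply: (@le_trans _ _ ((1 + C0^-1) ^+ #|` us j|)).
  by rewrite lerXn2r ?nnegrE ?invr_ge0 ?(ltW hC0) ?(le_trans ler01 C1)// lerDr.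
by rewrite ler_weXn2l// card_us.
Qed.

Variables (m : nat) (ns : nat -> nat).
Hypothesis ns0 : forall k, (0 < ns k)%N.

Let Q := multilevel a t c phi vs m ns.

Let vs0 : vs 0%N = fset0. Proof. by []. Qed.
Let vs_mono k l : (k <= l)%N -> (vs k `<=` vs l)%fset.
Proof. exact: level_mono. Qed.
Let XD : X `<=` box D. Proof. by move=> x []. Qed.
Let Xanchor v z : box D z -> X (anchor_at c v z).
Proof. exact: (anchor_in_weighted_domain gam v hK). Qed.

Lemma multilevel_nodes_in p : p \in Q -> X p.2.
Proof. exact: (multilevel_in (anchor_in hK) ht Xanchor). Qed.

Let Gam := (1 + C0^-1) ^+ d.

Let term j : R :=
  \sum_(1 <= k < m.+1) (if (j < level_size L b k.-1)%N then 0 else Gam * h j) * e (ns k) ^+ 2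
  + (if (j < level_size L b m)%N then 0 else h j).

Let Gam0 : 0 <= Gam. Proof. by rewrite exprn_ge0// addr_ge0// invr_ge0 ltW. Qed.

(** If k is the first level that contains [us j], then j is not below the size
    of level k - 1 and the error is that of Q_(n_k); this is one of the terms of
    the sum, and the others are nonnegative. If no level contains [us j], the
    algorithm is zero on the component and the last term remains. *)
Lemma weighted_sqr_error_le j :
  w j.+1 * sqr_error mu X (coord_kernel K (us j)) Q <= term j.
Proof.
have mX := multilevel_domain_measurable; have muX := multilevel_domain_full.
have hj := scaled_weight_ge0 j.
have term1 k : 0 <= (if (j < level_size L b k.-1)%N then 0 else Gam * h j) * e (ns k) ^+ 2.
  by rewrite mulr_ge0 ?sqr_ge0//; case: ifP => // _; rewrite mulr_ge0.
have term2 : 0 <= (if (j < level_size L b m)%N then 0 else h j) by case: ifP.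
have sum1 : 0 <= \sum_(1 <= k < m.+1)
    (if (j < level_size L b k.-1)%N then 0 else Gam * h j) * e (ns k) ^+ 2.
  by apply: sumr_ge0.
rewrite /w /=; have [uE|u0] := eqVneq (us j) fset0.
  by rewrite mul0r addr_ge0.
have au : active gam (us j) by case: hus => + _ _ _; apply.
have outside k : ~~ (us j `<=` vs k)%fset -> (j < level_size L b k)%N = false.
  by move=> jk; apply/negbTE; apply: contra jk => /(level_sup us).
have [um|um] := boolP (us j `<=` vs m)%fset; last first.
  rewrite (sqr_error_multilevel_outside (anchor_in hK) phi a ht ns vs_mono hK mD hM hmu
    mX XD muX Xanchor um).
  rewrite /term (outside _ um) ler_wpDl//.
  by rewrite /h (negbTE u0).
have ex : exists k, (us j `<=` vs k)%fset by exists m.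
case: (ex_minnP ex) => k uk kmin.
have k0 : (0 < k)%N.
  by rewrite lt0n; apply: contraNneq u0 => k0; move: uk; rewrite k0 fsubset0.
have km : (k <= m)%N by exact: kmin.
have uk1 : ~~ (us j `<=` vs k.-1)%fset.
  by apply/negP => /kmin; rewrite leqNgt prednK// leqnn.
have kmm : (0 < k <= m)%N by rewrite k0.
rewrite (sqr_error_multilevel (anchor_in hK) phi a ht ns vs_mono hK mu mX XD Xanchor
  u0 kmm uk uk1).
have QlX p : p \in quadrature_lift a t c phi (ns k) (vs k) -> X p.2.
  by move=> /(quadrature_lift_node ht)[z Dz ->]; exact: Xanchor.
have le_e := sqr_error_lift hK mD rhoD hM hmu mX XD muX (phi_inj au) uk
  (@hrhou (image_set phi (us j))) QlX (e0 (ns k))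
  (herr (ns0 k) (image_set phi (us j))).
rewrite /term (@bigD1_seq _ _ _ _ _ k)/=; [|by rewrite mem_index_iota ltnS k0|exact: iota_uniq].
rewrite (outside _ uk1) -addrA ler_wpDr ?addr_ge0//.
  by apply: sumr_ge0.
apply: (@le_trans _ _ (gam (us j) * e (ns k) ^+ 2)); first by rewrite ler_wpM2l.
by rewrite ler_wpM2r ?sqr_ge0// weight_le_scaled.
Qed.

Variables (tau G : R).
Hypotheses (tau0 : 0 < tau) (G0 : 0 <= G).
Hypothesis hG : forall j, h j <= G * j.+1%:R `^ (- (tau + 1)).

Let T := tail_const b tau G.

(** The bounds for the single components, summed over the components first and
    over the levels second. *)
Lemma sqr_error_multilevel_le :
  sqr_error mu X (weighted_kernel K gam) Q <=
  \sum_(1 <= k < m.+1) Gam * (T * (b `^ tau) ^- k.-1) * e (ns k) ^+ 2 +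
  T * (b `^ tau) ^- m.
Proof.
have mX := multilevel_domain_measurable; have muX := multilevel_domain_full.
have cvgE := sqr_error_weighted hK mD rhoD hM hmu gam0 w0 esumE wsum multilevel_nodes_in.
apply: (cvgr_to_le cvgE); apply: nearW => -[|N].
  rewrite big_ord0 addr_ge0//.
    apply: sumr_ge0 => k _; rewrite mulr_ge0 ?sqr_ge0// mulr_ge0//.
    by rewrite divr_ge0 ?exprn_ge0 ?powR_ge0//; exact: tail_const_ge0.
  by rewrite divr_ge0 ?exprn_ge0 ?powR_ge0//; exact: tail_const_ge0.
rewrite big_ord_recl /= [X in _ * X](sqr_error_multilevel_cst (anchor_in hK) phi a ht
  vs m ns K mX muX Xanchor) mulr0 add0r.
apply: (@le_trans _ _ (\sum_(j < N) term j)).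
  by apply: ler_sum => j _; exact: weighted_sqr_error_le.
rewrite big_split/= exchange_big/=; apply: lerD; last first.
  exact: (tail_weights_le L0 b1 tau0 G0 scaled_weight_ge0 hG).
apply: ler_sum => k _; rewrite -mulr_suml ler_wpM2r ?sqr_ge0//.
rewrite (eq_bigr (fun j : 'I_N => Gam * (if (j < level_size L b k.-1)%N then 0 else h j))).
  rewrite -mulr_sumr ler_wpM2l//.
  exact: (tail_weights_le L0 b1 tau0 G0 scaled_weight_ge0 hG).
by move=> j _; case: ifP; rewrite ?mulr0.
Qed.


End multilevel_error.

(** * The exponent of tractability *)

(** The set v_k has at most d L_k elements and L_k <= 2 L b^k, so evaluations on
    level k cost O((b^s)^k). *)
Lemma cost_multilevel_growth (R : realType) (cost : nat -> R) (c s b : R)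
    (d L : nat) (phi : nat -> 'I_d) (a : forall n, 'I_n -> R)
    (t : forall n, 'I_n -> coords R 'I_d) (us : nat -> {fset nat}) :
  (forall k, 1 <= cost k) -> {homo cost : k l / (k <= l)%N >-> k <= l} ->
  0 <= s -> cost =O_\oo (fun k : nat => k%:R `^ s) -> (0 < L)%N -> 1 < b ->
  (forall j, (#|` us j| <= d)%N) ->
  exists2 A : R, 0 <= A & forall m ns,
    (cost_nest cost c (multilevel a t c phi (level us L b) m ns) <=
     (cost 0%N + A * \sum_(1 <= k < m.+1) (ns k)%:R * (b `^ s) ^+ k)%:E)%E.
Proof.
move=> cost1 cmono s0 costO L0 b1 usd.
have b0 : 0 < b := lt_trans ltr01 b1.
have [A [N [A0 N0 HA]]] := cost_growth s0 cmono costO.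
pose P : R := (d * (2 * L) + N)%:R.
exists (2 * (A * P `^ s)); first by rewrite mulr_ge0// mulr_ge0 ?powR_ge0// ltW.
move=> m ns.
have vsS k : (level us L b k `<=` level us L b k.+1)%fset.
  exact: (level_mono us L0 b1 (leqnSn k)).
apply: (le_trans (cost_nest_multilevel_le cost c phi a t m ns erefl vsS)).
rewrite lee_fin lerD2l mulr_sumr; apply: ler_sum => k _.
have bk : 1 <= b ^+ k by rewrite exprn_ege1// ltW.
have le1 : (#|` level us L b k| + N)%:R <= P * b ^+ k.
  rewrite /P !natrD mulrDl; apply: lerD; last by rewrite ler_peMr.
  apply: (@le_trans _ _ (d%:R * (level_size L b k)%:R)).
    by rewrite -natrM ler_nat; exact: card_level.
  by rewrite natrM -mulrA ler_wpM2l// level_size_le.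
have le2 : cost #|` level us L b k| <= A * P `^ s * (b `^ s) ^+ k.
  apply: (le_trans (HA _)); rewrite -mulrA ler_wpM2l ?(ltW A0)//.
  rewrite (powR_exprn _ _ (ltW b0)) -powRM ?exprn_ge0 ?(ltW b0)//.
  by apply: ge0_ler_powR => //; rewrite nnegrE// mulr_ge0// exprn_ge0// ltW.
rewrite natrM; apply: (le_trans (ler_wpM2l _ le2)); first by rewrite mulr_ge0.
by rewrite le_eqVlt; apply/orP; left; apply/eqP; ring.
Qed.

(** Uniform in the number k <= d of coordinates, with the logarithms traded for
    a smaller exponent. *)
Lemma quadrature_error_le (R : realType) (d : nat)
    (c1 C beta1 beta2 alpha al : R) : 0 <= c1 -> 0 <= C -> 0 <= beta1 ->
  0 <= beta2 -> al < alpha ->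
  exists2 E : R, 0 <= E & forall n k, (k <= d)%N ->
    c1 * C ^+ k * n.+1%:R `^ (- alpha) *
      (1 + ln n.+1%:R) `^ (beta1 * k%:R + beta2) <= E * n.+1%:R `^ (- al).
Proof.
move=> c10 C0 b10 b20 alal.
have be0 : 0 <= beta1 * d%:R + beta2 by rewrite addr_ge0// mulr_ge0.
have [A A0 HA] := powR_log_le alal be0.
exists (c1 * (1 + C) ^+ d * A).
  by rewrite !mulr_ge0 ?exprn_ge0 ?addr_ge0// ltW.
move=> n k kd; have n1 : 1 <= n.+1%:R :> R by rewrite ler1n.
rewrite -[leRHS]mulrA -[leLHS]mulrA; apply: ler_pM.
- by rewrite mulr_ge0// exprn_ge0.
- by rewrite mulr_ge0 ?powR_ge0.
- rewrite ler_wpM2l//; apply: (@le_trans _ _ ((1 + C) ^+ k)).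
    by rewrite lerXn2r ?nnegrE ?addr_ge0// lerDr.
  by rewrite ler_weXn2l// lerDl.
apply: le_trans (HA _ n1); rewrite ler_wpM2l ?powR_ge0//.
apply: ler_powR; first by rewrite lerDl ln_ge0.
by rewrite lerD2r ler_wpM2l// ler_nat.
Qed.

Lemma cost_nest_nil (R : realType) (cost : nat -> R) (c : R) :
  (cost_nest cost c [::] <= 0)%E.
Proof.
have [w wn _] := @nested_through (fun=> fset0) 0 erefl (fun _ => fsubset_refl _).
by apply: ereal_inf_lbound; exists w => //; rewrite big_nil.
Qed.

(** For eps > 1 two algorithms suffice: the empty one, of cost zero, beyond the
    bound r for the norm of the integral, and the one for eps = 1 in between. *)
Lemma p_nest_le (R : realType) (D : set R) (c : R) (cost : nat -> R)
    (mu : probability (coords R nat) R) (X : set (coords R nat))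
    (K : coords R nat -> coords R nat -> R) (H : rkhs X K) (p r : R) :
  0 <= p -> 0 <= r -> (worst_case_error mu H [::] <= r%:E)%E ->
  (exists C : R, forall eps : R, 0 < eps -> eps <= 1 ->
    exists Q, [/\ admissible D c Q, (worst_case_error mu H Q <= eps%:E)%E &
      (cost_nest cost c Q <= (C * eps `^ (- p))%:E)%E]) ->
  (p_nest D c cost mu H <= p%:E)%E.
Proof.
move=> p0 r0 Hr [C HC]; apply: ereal_inf_lbound; exists p => //=; split => //.
have comp_le eps Q : admissible D c Q -> (worst_case_error mu H Q <= eps%:E)%E ->
    (comp_nest D c cost mu H eps <= cost_nest cost c Q)%E.
  by move=> aQ eQ; apply: ereal_inf_lbound; exists Q.
exists (`|C| * (1 + r) `^ p); first by rewrite mulr_ge0 ?powR_ge0.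
move=> eps e0.
have r1 : 1 <= 1 + r by rewrite lerDl.
have [re|er] := leP r eps.
  apply: (@le_trans _ _ 0%E); last by rewrite lee_fin !mulr_ge0 ?powR_ge0.
  apply: le_trans (cost_nest_nil cost c); apply: comp_le => //.
  by rewrite (le_trans Hr)// lee_fin.
have [e1|e1] := leP eps 1.
  have [Q [aQ eQ cQ]] := HC eps e0 e1.
  rewrite (le_trans (comp_le eps Q aQ eQ))// (le_trans cQ)// lee_fin.
  rewrite ler_wpM2r ?powR_ge0// (le_trans (ler_norm _))// ler_peMr//.
  exact: powR_ge1.
have [Q [aQ eQ cQ]] := HC 1 ltr01 (lexx _).
have eQ' : (worst_case_error mu H Q <= eps%:E)%E by rewrite (le_trans eQ)// lee_fin ltW.
rewrite (le_trans (comp_le eps Q aQ eQ'))// (le_trans cQ)// lee_fin powR1 mulr1.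
rewrite (le_trans (ler_norm _))// -mulrA ler_peMr// powRN ler_pdivlMr ?powR_gt0// mul1r.
apply: ge0_ler_powR; rewrite ?nnegrE ?(ltW e0) ?addr_ge0//.
by rewrite (le_trans (ltW er))// lerDr.
Qed.

Theorem theorem8 (R : realType)
  (* the kernel, the probability measure rho on D, and the product measure *)
  (D : set R) (hD : measurable D) (c : R) (K : R -> R -> R)
  (hK : is_anchored_kernel D c K)
  (rho : probability R R) (hrho : rho D = 1%E)
  (hM : (diag_integral D K rho < +oo)%E)
  (hC0 : 0 < double_integral D K rho)
  (mu : probability (coords R nat) R) (hmu : is_product_measure rho mu)
  (* the weights and the space H_gamma *)
  (gam : {fset nat} -> R)
  (hgam : is_weights gam (fine (diag_integral D K rho)))
  (H : rkhs (weighted_domain D K gam) (weighted_kernel K gam))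
  (us : nat -> {fset nat})
  (hus : is_weight_order gam (double_integral D K rho) us)
  (hfin : exists d' : nat, is_algorithmic_dimension (active gam) d')
  (hdecay : (1 < decay gam (double_integral D K rho) us)%E)
  (* the cost function *)
  (cost : nat -> R) (hcost1 : forall k, 1 <= cost k)
  (hcost_mono : {homo cost : k l / (k <= l)%N >-> k <= l})
  (s : R) (hs : 0 <= s)
  (hcostO : cost =O_\oo (fun k : nat => k%:R `^ s))
  (* the set W of algorithmic dimension d *)
  (W : set {fset nat}) (d : nat) (hWd : is_algorithmic_dimension W d)
  (hW : active gam `<=` W)
  (phi : nat -> 'I_d) (hphi : injective_on_members W phi)
  (* the quadratures Q_n on D^d, the spaces H_u and the measures rho^u *)
  (a : forall n, 'I_n -> R) (t : forall n, 'I_n -> coords R 'I_d)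
  (ht : forall n (i : 'I_n), box D (t n i))
  (Hu : forall u : {set 'I_d}, rkhs (box D) (@tensor_kernel R {j | j \in u} K))
  (rhou : forall u : {set 'I_d}, probability (coords R {j | j \in u}) R)
  (hrhou : forall u, is_product_measure rho (rhou u))
  (alpha : R) (halpha : 0 < alpha) (c1 C beta1 beta2 : R)
  (hc1 : 0 <= c1) (hC : 0 <= C) (hbeta1 : 0 <= beta1) (hbeta2 : 0 <= beta2)
  (herr : forall n, (0 < n)%N -> forall u : {set 'I_d},
     (worst_case_error (rhou u) (Hu u) (quadrature_proj a t n u) <=
      (c1 * C ^+ #|u| * n.+1%:R `^ (- alpha) *
       (1 + ln n.+1%:R) `^ (beta1 * #|u|%:R + beta2))%:E)%E)
  (* the parameters of the levels *)
  (L : nat) (hL : (0 < L)%N) (b : R) (hb : 1 < b) :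
  let B : \bar R :=
    maxe (alpha^-1)%:E
         ((2 * s)%:E / (decay gam (double_integral D K rho) us - 1))%E in
  (forall p : R, (B < p%:E)%E ->
     exists C' : R, forall eps : R, 0 < eps -> eps <= 1 ->
       exists (m : nat) (ns : nat -> nat),
         [/\ (0 < m)%N,
             forall k, (0 < k <= m)%N -> (0 < ns k)%N,
             forall k l, (0 < k)%N -> (k <= l <= m)%N -> (ns l <= ns k)%N,
             (worst_case_error mu H
                (multilevel a t c phi (level us L b) m ns) <= eps%:E)%E &
             (cost_nest cost c
                (multilevel a t c phi (level us L b) m ns) <=
              (C' * eps `^ (- p))%:E)%E]) /\
  (p_nest D c cost mu H <= B)%E.
Proof.
move=> B.
have phi_inj u : active gam u -> {in u &, injective phi}.
  by move=> /hW; exact: hphi.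
have Dc := anchor_in hK.
have mX := multilevel_domain_measurable hK hD hrho hM hmu hgam hus.
have mK := multilevel_section_measurable hK hD hgam hus.
have iK := multilevel_diag_integrable hK hD hrho hM hmu hgam hus.
have L0 := hL.
pose Q m ns := multilevel a t c phi (level us L b) m ns.
have QX m ns p : p \in Q m ns -> weighted_domain D K gam p.2.
  exact: (multilevel_in Dc ht (fun v z => @anchor_in_weighted_domain _ _ _ _ gam v z hK)).
have H1 : forall p : R, (B < p%:E)%E ->
     exists C' : R, forall eps : R, 0 < eps -> eps <= 1 ->
       exists (m : nat) (ns : nat -> nat),
         [/\ (0 < m)%N,
             forall k, (0 < k <= m)%N -> (0 < ns k)%N,
             forall k l, (0 < k)%N -> (k <= l <= m)%N -> (ns l <= ns k)%N,
             (worst_case_error mu H (Q m ns) <= eps%:E)%E &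
             (cost_nest cost c (Q m ns) <= (C' * eps `^ (- p))%:E)%E].
  move=> p; rewrite gt_max lte_fin => /andP[alp decp].
  have p0 : 0 < p by apply: lt_trans alp; rewrite invr_gt0.
  have [tau tau0 [stau ctau]] := decay_rate hs p0 hdecay decp.
  have [G G0 hG] := decay_bound ctau.
  (* any al strictly between 1 / p and alpha *)
  pose al := (alpha + p^-1) / 2.
  have pinv : p^-1 < alpha by rewrite -(invrK alpha) ltf_pV2 ?posrE ?invr_gt0.
  have al0 : 0 < al by rewrite divr_gt0// addr_gt0// invr_gt0.
  have alal : al < alpha by rewrite /al; lra.
  have pal : 1 < p * al.
    by rewrite -ltr_pdivrMl// mulr1 /al; lra.
  have [E0 E00 HE0] := quadrature_error_le d hc1 hC hbeta1 hbeta2 alal.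
  pose e n := E0 * n.+1%:R `^ (- al).
  have e0 n : 0 <= e n by rewrite mulr_ge0 ?powR_ge0.
  have herr' n : (0 < n)%N -> forall u : {set 'I_d},
      (worst_case_error (rhou u) (Hu u) (quadrature_proj a t n u) <= (e n)%:E)%E.
    move=> n0 u; apply: (le_trans (herr n n0 u)); rewrite lee_fin; apply: HE0.
    by rewrite (leq_trans (max_card _))// card_ord.
  pose x := b `^ tau; pose y := b `^ s.
  have b0 : 0 < b := lt_trans ltr01 hb.
  have lnb : 0 < ln b by rewrite ln_gt0.
  have x1 : 1 < x.
    by rewrite /x powRE// -expR0 ltr_expR mulr_gt0.
  have x0 : 0 < x := lt_trans ltr01 x1.
  have y1 : 1 <= y by rewrite powR_ge1// ltW.
  have yx : y < x `^ (p / 2).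
    rewrite /x /y -powRrM !powRE// ltr_expR ltr_pM2r//.
    by rewrite mulrA ltr_pdivlMr// mulrC (mulrC tau).
  pose Gam := (1 + (double_integral D K rho)^-1) ^+ d.
  have Gam0 : 0 <= Gam by rewrite exprn_ge0// addr_ge0// invr_ge0 ltW.
  pose T := tail_const b tau G.
  have T0 : 0 <= T by exact: tail_const_ge0.
  have E1 : 0 <= Gam * (T * x) * E0 ^+ 2.
    exact: mulr_ge0 (mulr_ge0 Gam0 (mulr_ge0 T0 (ltW x0))) (exprn_ge0 2 E00).
  have [C1 C10 HC1] := multilevel_parameters x1 y1 p0 al0 pal yx E1 T0.
  have usd j : (#|` us j| <= d)%N by exact: (card_us hus phi_inj).
  have [A A0 HA] := cost_multilevel_growth c phi a t hcost1 hcost_mono hs hcostO hL hb usd.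
  exists (cost 0%N + A * C1) => eps eps0 eps1.
  have [m [ns [m0 ns0 nsmono errm costm]]] := HC1 eps eps0 eps1.
  exists m, ns; split => //.
  - by move=> k l _ /andP[kl _]; exact: nsmono.
  - have [s0 ->] := worst_case_errorE mX H mK iK (QX m ns).
    rewrite lee_fin -(ger0_norm (ltW eps0)) -sqrtr_sqr ler_wsqrtr//.
    apply: le_trans errm.
    have := sqr_error_multilevel_le hK hD hrho hM hC0 hmu hgam hus phi_inj ht
      hrhou e0 herr' hL hb m ns0 tau0 G0 hG.
    move/le_trans; apply; rewrite lerD2r big_nat [leRHS]big_nat.
    apply: ler_sum => -[//|k] _.
    rewrite -/Gam -/T -/x (exprS x) /e exprMn /=.
    have -> : (ns k.+1).+1%:R `^ (- al) ^+ 2 =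
        (ns k.+1).+1%:R `^ (- (2 * al)) :> R.
      by rewrite -powR_mulrn ?powR_ge0// -powRrM; congr (_ `^ _); ring.
    rewrite le_eqVlt; apply/orP; left; apply/eqP; field.
    by rewrite expf_neq0 ?gt_eqF.
  - apply: (le_trans (HA m ns)); rewrite lee_fin mulrDl; apply: lerD.
      rewrite ler_peMr// ?(le_trans ler01)//.
      rewrite powRN invf_ge1 ?powR_gt0//.
      apply: (@le_trans _ _ (1 `^ p)); last by rewrite powR1.
      by apply: ge0_ler_powR; rewrite ?nnegrE// ltW.
    by rewrite -mulrA ler_wpM2l.
split; first exact: H1.
have nilX (p : R * coords R nat) : p \in [::] -> weighted_domain D K gam p.2 by [].
have [_ rE] := worst_case_errorE mX H mK iK nilX.
have Hp p : (B < p%:E)%E -> (p_nest D c cost mu H <= p%:E)%E.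
  move=> Bp.
  have p0 : 0 < p.
    have := Bp; rewrite gt_max lte_fin => /andP[alp _].
    by apply: lt_trans alp; rewrite invr_gt0.
  apply: (p_nest_le (ltW p0) (sqrtr_ge0 _)); first by rewrite rE.
  have [C' HC'] := H1 p Bp; exists C' => eps e0 e1.
  have [m [ns [_ _ _ Qe Qc]]] := HC' eps e0 e1.
  exists (Q m ns); split => //; exact: (admissible_multilevel Dc ht).
have : (alpha^-1%:E <= B)%E by rewrite le_max lexx.
case EB : B => [r| |] // _; last by rewrite leey.
apply/lee_addgt0Pr => e e0; rewrite -EFinD; apply: Hp.
by rewrite EB lte_fin ltrDl.
Qed.
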